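(* Let $c\in\mathbf R$, $c\ne0$. Let $$M=T_1S^{n+1}=\{(x,y)\in\mathbf E^{n+2}\times\mathbf E^{n+2}\mid |x|=1,\ |y|=1,\ x\cdot y=0\},$$ with coordinates $x=(x_0,\dots,x_{n+1})$, $y=(y_0,\dots,y_{n+1})$, with contact form $\theta=\sum_{i=0}^{n+1}y_idx_i$ and projections $\pi_1(x,y)=x\in W_1=S^{n+1}$, $\pi_2(x,y)=y\in W_2=S^{n+1}$. Let $\Omega_1=c\,i_X(dx_0\wedge\cdots\wedge dx_{n+1})$ on $W_1$ and $\Omega_2=i_Y(dy_0\wedge\cdots\wedge dy_{n+1})$ on $W_2$, where $X=\sum_{i=0}^{n+1}x_i\frac{\partial}{\partial x_i}$, $Y=\sum_{i=0}^{n+1}y_i\frac{\partial}{\partial y_i}$, and let $R=\sum_{i=0}^{n+1}\big(y_i\frac{\partial}{\partial x_i}-x_i\frac{\partial}{\partial y_i}\big)$ be the Reeb vector field of $\theta$. Then the associated Monge--Ampère system $\mathcal M$ with Lagrangian pair on $M$, that is, the system with Lagrangian pair $(\ker(\pi_2)_*,\ker(\pi_1)_* )$ induced from $\Omega_1,\Omega_2$, is generated by $\theta$ and $$\begin{aligned}\omega&=i_R(\pi_1^*\Omega_1-\pi_2^*\Omega_2)\\&=c\sum_{0\le j<i\le n+1}(-1)^{i+j}x_iy_j\,dx_0\wedge\cdots\wedge\breve{dx_j}\wedge\cdots\wedge\breve{dx_i}\wedge\cdots\wedge dx_{n+1}\\&\quad-c\sum_{0\le i<k\le n+1}(-1)^{i+k}x_iy_k\,dx_0\wedge\cdots\wedge\breve{dx_i}\wedge\cdots\wedge\breve{dx_k}\wedge\cdots\wedge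 dx_{n+1}\\&\quad+\sum_{0\le j<i\le n+1}(-1)^{i+j}y_ix_j\,dy_0\wedge\cdots\wedge\breve{dy_j}\wedge\cdots\wedge\breve{dy_i}\wedge\cdots\wedge dy_{n+1}\\&\quad-\sum_{0\le i<k\le n+1}(-1)^{i+k}y_ix_k\,dy_0\wedge\cdots\wedge\breve{dy_i}\wedge\cdots\wedge\breve{dy_k}\wedge\cdots\wedge dy_{n+1}.\end{aligned}$$ The Gaussian curvature of the projection to $W_1=S^{n+1}$ of a geometric solution of $\mathcal M$ is equal to the constant $c$ outside of the singular locus, while the Gaussian curvature of the projection to $W_2=S^{n+1}$ of a geometric solution of $\mathcal M$ is equal to the constant $\frac1c$ outside of the singular locus.
   Context: $x\cdot y$ is the standard inner product on Euclidean space $\mathbf E^{n+2}$; $\breve{\ }$ means that the factor is omitted; forms are restricted to $M$. A Lagrangian pair on a contact manifold $(M^{2n+1},D=\{\theta=0\})$ is a pair $(E_1,E_2)$ of rank-$n$ subbundles of $D$, isotropic for $d\theta$, with $D=E_1\oplus E_2$. A (bi-decomposable) Monge--Ampère system with Lagrangian pair $(E_1,E_2)$ is an ideal $\langle\theta,d\theta,\omega\rangle$ of differential forms, where (locally) $\omega=\omega_1-\omega_2$ with $n$-forms such that $i_u\omega_1=0$ for $u\in E_2$, $i_v\omega_2=0$ for $v\in E_1$, $\omega_1|_{E_1}$ is a volume form on $E_1$ and $\omega_2|_{E_2}$ is a volume form on $E_2$ (these conditions and the equality of generators being understood up to adding multiples of $\theta$). The Reeb field of $\theta$ is the vector field $R$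 with $i_R\theta=1$, $i_Rd\theta=0$. Given fibrations $\pi_1,\pi_2$ with $\ker(\pi_1)_*=E_2$, $\ker(\pi_2)_*=E_1$ and volume forms $\Omega_1,\Omega_2$ on their bases, the system induced from $\Omega_1,\Omega_2$ is the one generated by $\theta$, $d\theta$ and $i_R(\pi_1^*\Omega_1-\pi_2^*\Omega_2)$. ''Generated by $\theta$ and $\omega$'' is as an exterior differential system, so $d\theta$ is included. A geometric solution of $\mathcal M$ is an immersion $g:L\to M$ of an $n$-dimensional manifold $L$ with $g^*\theta=0$ and $g^*\omega=0$. The singular locus of its projection to $W_j$ is the set where $\pi_j\circ g$ is not an immersion. Outside it, $\pi_1\circ g$ is an immersed hypersurface of $S^{n+1}$ with unit normal $y$, and $\pi_2\circ g$ is an immersed hypersurface of $S^{n+1}$ with unit normal $x$. The Gaussian (Gauss--Kronecker) curvature $K$ of a hypersurface of $S^{n+1}$ with unit normal $N$ is the determinant of the differential $dN$ (the derivative of $N$ as an $\mathbf E^{n+2}$-valued map, which takes values in the tangent space of the hypersurface). *)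

(* Defs.v *)
From HB Require Import structures.
From mathcomp Require Import all_boot all_order all_algebra.
From mathcomp Require Import all_fingroup.
From mathcomp Require Import all_classical all_reals all_analysis.
Set Implicit Arguments.
Unset Strict Implicit.
Unset Printing Implicit Defensive.
Import Order.TTheory GRing.Theory Num.Theory.
Import numFieldNormedType.Exports.
Local Open Scope classical_set_scope.
Local Open Scope ring_scope.

(* Class C^k on an open set, for maps between finite-dimensional spaces. *)
Fixpoint Ck_on (R : realType) (V W : normedModType R) (k : nat) (U : set V)
    (f : V -> W) : Prop :=
  match k with
  | 0 => forall x, U x -> {for x, continuous f}
  | k'.+1 => (forall x, U x -> differentiable f x) /\
             (forall v : V, Ck_on k' U (fun x => 'D_v f x))
  end.

Definition smooth_on (R : realType) (V W : normedModType R) (U : set V)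
    (f : V -> W) : Prop := forall k, Ck_on k U f.

(* A k-form on V assigns to p and v_0, ..., v_{k-1} the number
   alpha p (v_0, ..., v_{k-1}).  [is_form] says that it is a smooth
   differential form. *)
Definition form (R : realType) (V : normedModType R) (k : nat) : Type :=
  V -> ('I_k -> V) -> R.

Section Forms.
Context {R : realType} {V W : normedModType R}.

Definition upd k (v : 'I_k -> V) (i : 'I_k) (u : V) : 'I_k -> V :=
  fun j => if j == i then u else v j.

Definition multilinear k (a : ('I_k -> V) -> R) : Prop :=
  forall (v : 'I_k -> V) (i : 'I_k) (t : R) (u w : V),
    a (upd v i (t *: u + w)) = t * a (upd v i u) + a (upd v i w).

Definition alternating k (a : ('I_k -> V) -> R) : Prop :=
  forall (v : 'I_k -> V) (i j : 'I_k), i != j -> v i = v j -> a v = 0.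

Definition is_form k (a : form V k) : Prop :=
  [/\ forall p, multilinear (a p),
      forall p, alternating (a p) &
      forall v, smooth_on setT (fun p => a p v : R^o)].

Definition addf k (a b : form V k) : form V k := fun p v => a p v + b p v.
Definition subf k (a b : form V k) : form V k := fun p v => a p v - b p v.
Definition scalef k (t : R) (a : form V k) : form V k := fun p v => t * a p v.
Definition zerof k : form V k := fun _ _ => 0.
Definition constf (t : R) : form V 0 := fun _ _ => t.

Definition wedge k l (a : form V k) (b : form V l) : form V (k + l) :=
  fun p v => (k`! * l`!)%N%:R^-1 *
    \sum_(s : 'S_(k + l)) (-1) ^+ s *
      a p (fun i => v (s (lshift l i))) * b p (fun j => v (s (rshift k j))).

(* The product a_0 /\ ... /\ a_{k-1} of 1-forms, consistent with [wedge]. *)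
Definition wedge1 k (a : 'I_k -> form V 1) : form V k :=
  fun p v => \det (\matrix_(i < k, j < k) a i p (fun=> v j)).

Definition vcons k (u : V) (v : 'I_k -> V) : 'I_k.+1 -> V :=
  fun i => if unlift ord0 i is Some j then v j else u.

Definition iprod k (X : V -> V) (a : form V k.+1) : form V k :=
  fun p v => a p (vcons (X p) v).

(* Cartan's formula, evaluated on constant vector fields. *)
Definition extd k (a : form V k) : form V k.+1 :=
  fun p v => \sum_(i < k.+1)
    (-1) ^+ i * 'D_(v i) (fun q => a q (fun j => v (lift i j)) : R^o) p.

Definition pullback k (f : V -> W) (a : form W k) : form V k :=
  fun p v => a (f p) (fun i => 'd f p (v i)).

(* A submanifold of V is given by its set of points M and by its tangent spaces
   T p, for p in M.  Forms on M are restrictions to M of forms on V. *)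
Definition eq_on (M : set V) (T : V -> set V) k (a b : form V k) : Prop :=
  forall p, M p -> forall v : 'I_k -> V, (forall i, T p (v i)) -> a p v = b p v.

Definition volume_form (M : set V) (T : V -> set V) k (a : form V k) : Prop :=
  is_form a /\
  forall p, M p -> exists v : 'I_k -> V, (forall i, T p (v i)) /\ a p v <> 0.

Definition hform : Type := {k : nat & form V k}.
Definition hf k (a : form V k) : hform := existT (form V) k a.

(* The ideal of forms on M generated by G (by its homogeneous elements);
   [ideal_eq] expresses that only restrictions to M matter. *)
Inductive ideal (M : set V) (T : V -> set V) (G : set hform) : hform -> Prop :=
| ideal_gen a : G a -> ideal M T G a
| ideal_zero k : ideal M T G (hf (@zerof k))
| ideal_add k (a b : form V k) : ideal M T G (hf a) -> ideal M T G (hf b) ->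
    ideal M T G (hf (addf a b))
| ideal_wedge k l (b : form V k) (a : form V l) : is_form b ->
    ideal M T G (hf a) -> ideal M T G (hf (wedge b a))
| ideal_eq k (a b : form V k) : ideal M T G (hf a) -> is_form b ->
    eq_on M T a b -> ideal M T G (hf b).

(* The exterior differential system generated by G: the ideal generated by the
   elements of G and their exterior derivatives. *)
Definition eds (M : set V) (T : V -> set V) (G : set hform) : set hform :=
  ideal M T (G `|` [set hf (extd (projT2 a)) | a in G]).

Definition ev1 (theta : form V 1) (p v : V) : R := theta p (fun=> v).
Definition ev2 (a : form V 2) (p u v : V) : R := a p (vcons u (fun=> v)).

Definition contact_dist (T : V -> set V) (theta : form V 1) : V -> set V :=
  fun p => [set v | T p v /\ ev1 theta p v = 0].

(* theta is nowhere zero on M and d theta is nondegenerate on D. *)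
Definition contact_form (M : set V) (T : V -> set V) (theta : form V 1) : Prop :=
  let D := contact_dist T theta in
  is_form theta /\
  forall p, M p ->
    (exists v, T p v /\ ev1 theta p v <> 0) /\
    (forall u, D p u -> (forall v, D p v -> ev2 (extd theta) p u v = 0) -> u = 0).

Definition reeb_field (M : set V) (T : V -> set V) (theta : form V 1)
    (X : V -> V) : Prop :=
  [/\ smooth_on setT X,
      forall p, M p -> T p (X p),
      eq_on M T (iprod X theta) (constf 1) &
      eq_on M T (iprod X (extd theta)) (@zerof 1)].

(* Rank-n subbundle of TM: locally spanned by a smooth frame. *)
Definition subbundle (M : set V) (T : V -> set V) (n : nat) (E : V -> set V)
    : Prop :=
  forall p, M p -> E p `<=` T p /\
  exists (U : set V) (e : 'I_n -> V -> V),
    [/\ open U, U p, forall i, smooth_on U (e i) &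
        forall q, M q -> U q ->
          (forall a : 'I_n -> R,
             \sum_(i < n) a i *: e i q = 0 -> forall i, a i = 0) /\
          (forall v, E q v <-> exists a : 'I_n -> R,
                                 v = \sum_(i < n) a i *: e i q)].

Definition lagrangian_pair (M : set V) (T : V -> set V) (theta : form V 1)
    (n : nat) (E1 E2 : V -> set V) : Prop :=
  let D := contact_dist T theta in
  [/\ subbundle M T n E1, subbundle M T n E2,
      forall p, M p -> E1 p `<=` D p /\ E2 p `<=` D p,
      forall p, M p -> forall u v, (E1 p u /\ E1 p v) \/ (E2 p u /\ E2 p v) ->
        ev2 (extd theta) p u v = 0 &
      forall p, M p -> forall v, D p v ->
        exists! uw : V * V, [/\ E1 p uw.1, E2 p uw.2 & v = uw.1 + uw.2]].

(* Conditions "up to multiples of theta" are tested on vectors of D = ker theta.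
   The decomposition omega = omega_1 - omega_2 is only required near each
   point. *)
Definition ma_system (M : set V) (T : V -> set V) (theta : form V 1)
    (n : nat) (E1 E2 : V -> set V) (I : set hform) : Prop :=
  let D := contact_dist T theta in
  exists w : form V n,
    [/\ is_form w,
        I = ideal M T [set hf theta; hf (extd theta); hf w] &
        forall p, M p -> exists (U : set V) (w1 w2 : form V n),
          [/\ open U /\ U p, is_form w1 /\ is_form w2 &
              forall q, M q -> U q ->
              [/\ forall v : 'I_n -> V, (forall i, D q (v i)) ->
                    w q v = w1 q v - w2 q v,
                  forall v : 'I_n -> V, (forall i, D q (v i)) ->
                    (exists i, E2 q (v i)) -> w1 q v = 0,
                  forall v : 'I_n -> V, (forall i, D q (v i)) ->
                    (exists i, E1 q (v i)) -> w2 q v = 0,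
                  exists v : 'I_n -> V, (forall i, E1 q (v i)) /\ w1 q v <> 0 &
                  exists v : 'I_n -> V, (forall i, E2 q (v i)) /\ w2 q v <> 0]]].

End Forms.

(* In the next two definitions X stands for the Reeb field of theta; Omega1 and
   Omega2 are volume forms on submanifolds of W1 and W2. *)
Definition induced_form (R : realType) (V W1 W2 : normedModType R) (n : nat)
    (X : V -> V) (pi1 : V -> W1) (pi2 : V -> W2)
    (Omega1 : form W1 n.+1) (Omega2 : form W2 n.+1) : form V n :=
  iprod X (subf (pullback pi1 Omega1) (pullback pi2 Omega2)).

Definition induced_system (R : realType) (V W1 W2 : normedModType R) (n : nat)
    (M : set V) (T : V -> set V) (theta : form V 1)
    (X : V -> V) (pi1 : V -> W1) (pi2 : V -> W2)
    (Omega1 : form W1 n.+1) (Omega2 : form W2 n.+1) : set (@hform R V) :=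
  ideal M T [set hf theta; hf (extd theta);
                 hf (induced_form X pi1 pi2 Omega1 Omega2)].

Definition vertical (R : realType) (V W : normedModType R) (T : V -> set V)
    (f : V -> W) : V -> set V :=
  fun p => [set v | T p v /\ 'd f p v = 0].

Record chart (R : realType) (n : nat) (L : topologicalType) := Chart {
  cdom : set L;
  cran : set 'rV[R]_n;
  cmap : L -> 'rV[R]_n;
  cinv : 'rV[R]_n -> L;
  open_cdom : open cdom;
  open_cran : open cran;
  cmapP : forall l, cdom l -> cran (cmap l) /\ cinv (cmap l) = l;
  cinvP : forall u, cran u -> cdom (cinv u) /\ cmap (cinv u) = u;
  cmap_cont : forall l, cdom l -> {for l, continuous cmap};
  cinv_cont : forall u, cran u -> {for u, continuous cinv}
}.

Section Manifolds.
Context {R : realType} {n : nat} {L : topologicalType}.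
Variable A : set (chart R n L).

Definition smooth_manifold : Prop :=
  [/\ hausdorff_space L, @second_countable L,
      forall l : L, exists2 c, A c & cdom c l &
      forall c c', A c -> A c' ->
        smooth_on (cran c `&` [set u | cdom c' (cinv c u)])
                  (fun u => cmap c' (cinv c u))].

Definition smooth_map (V : normedModType R) (g : L -> V) : Prop :=
  forall c, A c -> smooth_on (cran c) (g \o cinv c).

(* The points where the differential of g, read in a chart, is not injective. *)
Definition singular_locus (V : normedModType R) (g : L -> V) : set L :=
  [set l | exists c, [/\ A c, cdom c l &
                         ~ injective ('d (g \o cinv c) (cmap c l))]].

(* g^* a = 0, read in the charts. *)
Definition pullback_zero (V : normedModType R) (g : L -> V) k (a : form V k) :
  Prop :=
  forall c, A c -> forall u, cran c u -> forall v : 'I_k -> 'rV[R]_n,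
    pullback (g \o cinv c) a u v = 0.

Definition geometric_solution (V : normedModType R) (M : set V)
    (theta : form V 1) (w : form V n) (g : L -> V) : Prop :=
  [/\ forall l, M (g l), smooth_map g, singular_locus g = set0,
      pullback_zero g theta & pullback_zero g w].
End Manifolds.

Section Sphere.
Context {R : realType} {n : nat}.
Local Notation E := 'rV[R]_n.+2.

(* The norm `|x| of the library is the sup norm on row vectors, so the Euclidean
   condition |x| = 1 is written dot x x = 1. *)
Definition dot (x y : E) : R := \sum_(i < n.+2) x 0 i * y 0 i.

Definition sphere : set E := [set x | dot x x = 1].
Definition tan_sphere (x : E) : set E := [set u | dot x u = 0].

(* dx_0 /\ ... /\ dx_{n+1} and the radial field on E. *)
Definition vol : form E n.+2 :=
  wedge1 (fun (i : 'I_n.+2) (_ : E) (v : 'I_1 -> E) => v ord0 0 i).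
Definition radial : E -> E := id.

(* K is the Gaussian curvature at l of the hypersurface h of the sphere with
   unit normal N: the determinant of dN as an endomorphism of the tangent space
   dh(T_l L), transported to R^n by the isomorphism dh.  The matrix B is unique
   since dh is injective, and det B does not depend on the chart. *)
Definition gauss_curvature (L : topologicalType) (A : set (chart R n L))
    (h N : L -> E) (l : L) (K : R) : Prop :=
  forall c, A c -> cdom c l ->
  let dh := 'd (h \o cinv c) (cmap c l) in
  let dN := 'd (N \o cinv c) (cmap c l) in
  injective dh /\
  [/\ sphere (h l), sphere (N l) /\ dot (N l) (h l) = 0,
      forall v : 'rV[R]_n, dot (N l) (dh v) = 0 &
      exists2 B : 'M[R]_n,
        forall v : 'rV[R]_n, dN v = dh (v *m B) & \det B = K].

Local Notation EE := (E * E)%type.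

Definition T1S : set EE :=
  [set p | [/\ dot p.1 p.1 = 1, dot p.2 p.2 = 1 & dot p.1 p.2 = 0]].

(* Kernel of the differentials of the equations defining T1S. *)
Definition tan_T1S (p : EE) : set EE :=
  [set v | [/\ dot p.1 v.1 = 0, dot p.2 v.2 = 0 &
               dot v.1 p.2 + dot p.1 v.2 = 0]].

Definition dx (i : 'I_n.+2) : form EE 1 := fun _ v => (v ord0).1 0 i.
Definition dy (i : 'I_n.+2) : form EE 1 := fun _ v => (v ord0).2 0 i.

Definition theta : form EE 1 :=
  fun p v => \sum_(i < n.+2) p.2 0 i * dx i p v.

Definition reebT1S (p : EE) : EE := (p.2, - p.1).

Definition Omega1 (c : R) : form E n.+1 := scalef c (iprod radial vol).
Definition Omega2 : form E n.+1 := iprod radial vol.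

(* a_0 /\ ... /\ a_{n+1} with the factors a_i and a_j omitted. *)
Definition breve2 (a : 'I_n.+2 -> form EE 1) (i j : 'I_n.+2) : form EE n :=
  let s := [seq k <- enum 'I_n.+2 | k \notin [:: i; j]] in
  wedge1 (fun m : 'I_n => a (nth ord0 s m)).

Definition omega_formula (c : R) : form EE n := fun p v =>
  let x i := p.1 0 i in
  let y i := p.2 0 i in
  c * (\sum_(i < n.+2) \sum_(j < n.+2 | (j < i)%N)
         (-1) ^+ (i + j) * x i * y j * breve2 dx j i p v)
  - c * (\sum_(i < n.+2) \sum_(k < n.+2 | (i < k)%N)
         (-1) ^+ (i + k) * x i * y k * breve2 dx i k p v)
  + \sum_(i < n.+2) \sum_(j < n.+2 | (j < i)%N)
         (-1) ^+ (i + j) * y i * x j * breve2 dy j i p v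
  - \sum_(i < n.+2) \sum_(k < n.+2 | (i < k)%N)
         (-1) ^+ (i + k) * y i * x k * breve2 dy i k p v.

End Sphere.

(* Main.v *)
(* At (x, y) one has omega = c det(x, y, dx, ..., dx) - det(x, y, dy, ..., dy).
   On vectors of ker theta every term of d omega is a determinant of n + 2 vectors
   orthogonal to x, or to y, hence vanishes; so d omega = theta /\ i_R d omega and
   adding d omega to the generators does not enlarge the ideal.
   On a solution whose projection to x is immersed, dx and dy take values
   in the n-dimensional space {x, y}^perp, so dy = B dx and omega becomes
   (c - det B) det(x, y, dx): its vanishing says that the curvature det B is c.
   Exchanging x and y gives 1/c. *)
From HB Require Import structures.
From mathcomp Require Import all_boot all_order all_algebra.
From mathcomp Require Import all_fingroup.
From mathcomp Require Import all_classical all_reals all_analysis.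
From mathcomp Require Import ring.
Require Import Defs.
Import Order.TTheory GRing.Theory Num.Theory.
Import numFieldNormedType.Exports.
Set Implicit Arguments.
Unset Strict Implicit.
Unset Printing Implicit Defensive.
Local Open Scope classical_set_scope.
Local Open Scope ring_scope.

(** * Alternating multilinear forms *)

(** Forms live on the whole space of pairs (x, y), and only their values at points of [T1S] on
    tangent vectors count. A multiplier in the ideal must nevertheless be smooth everywhere; i_R d
    omega is, because the Reeb field is the restriction of a linear map. The factorisation of d
    omega comes from splitting a tangent vector as v = v' + theta(v) R with v' in ker theta.
    Expanding d omega on the vectors v', the terms with R in two slots vanish, and what is left is d
    omega(v) minus the product of theta with i_R d omega. The left-hand side is zero, since d omega
    vanishes on ker theta. On a solution, dx is orthogonal to x and dy to y because |x| = |y| = 1,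
    dx is orthogonal to y because theta = 0, and then dy is orthogonal to x by differentiating x.y =
    0. When dx is injective, x, y and the image of dx span the whole space, and this is what
    produces the endomorphism B. *)

Section Alternating.
Context {R : realType} {V : normedModType R}.
Implicit Types (k n : nat) (u w : V).

Lemma upd_eq k (v : 'I_k -> V) i u : upd v i u i = u.
Proof. by rewrite /upd eqxx. Qed.

Lemma upd_neq k (v : 'I_k -> V) i u j : j != i -> upd v i u j = v j.
Proof. by rewrite /upd => /negbTE->. Qed.

Lemma upd_id k (v : 'I_k -> V) i : upd v i (v i) = v.
Proof. by apply/funext => j; rewrite /upd; case: eqP => // ->. Qed.

Lemma updC k (v : 'I_k -> V) i j u w : i != j ->
  upd (upd v i u) j w = upd (upd v j w) i u.
Proof.
move=> ij; apply/funext => l; rewrite /upd.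
by case: eqP => // ->; rewrite eq_sym (negbTE ij).
Qed.

Lemma upd_comp k m (v : 'I_k -> V) (f : 'I_m -> 'I_k) i u : injective f ->
  upd v (f i) u \o f = upd (v \o f) i u.
Proof. by move=> fI; apply/funext => j; rewrite /upd /= (inj_eq fI). Qed.

Lemma upd_comp_notin k m (v : 'I_k -> V) (f : 'I_m -> 'I_k) i u :
  (forall j, f j != i) -> upd v i u \o f = v \o f.
Proof. by move=> fi; apply/funext => j; rewrite /= upd_neq. Qed.

Section Multilinear.
Context {k : nat} (a : ('I_k -> V) -> R).
Hypothesis a_lin : multilinear a.

Lemma mlin_add v i u w : a (upd v i (u + w)) = a (upd v i u) + a (upd v i w).
Proof. by have := a_lin v i 1 u w; rewrite scale1r mul1r. Qed.

Lemma mlin_0 v i : a (upd v i 0) = 0.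
Proof.
have := mlin_add v i 0 0; rewrite addr0 => /eqP.
by rewrite eq_sym -subr_eq0 addrK => /eqP.
Qed.

Lemma mlin_scale v i t u : a (upd v i (t *: u)) = t * a (upd v i u).
Proof. by have := a_lin v i t u 0; rewrite addr0 mlin_0 addr0. Qed.

Lemma mlin_zero v i : v i = 0 -> a v = 0.
Proof. by move=> vi; rewrite -(upd_id v i) vi mlin_0. Qed.

Lemma mlin_sum v i (I : finType) (f : I -> R) (e : I -> V) :
  a (upd v i (\sum_j f j *: e j)) = \sum_j f j * a (upd v i (e j)).
Proof.
elim/big_ind2: _ => [|x y z t <- <-|j _]; first exact: mlin_0.
  exact: mlin_add.
exact: mlin_scale.
Qed.

Hypothesis a_alt : alternating a.

(** Polarization: the form vanishes with x + y in both slots, and so do the two diagonal terms of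
    its expansion. *)
Lemma alt_tperm v i j : i != j -> a (v \o tperm i j) = - a v.
Proof.
move=> ij; pose b x y := a (upd (upd v i x) j y).
have bD x y : b x y = - b y x.
  have : b (x + y) (x + y) = 0.
    by apply: (a_alt ij); rewrite upd_eq upd_neq // upd_eq.
  have b0 z : b z z = 0 by apply: (a_alt ij); rewrite upd_eq upd_neq // upd_eq.
  rewrite /b mlin_add ![upd (upd v i (x + y)) _ _]updC // !mlin_add.
  rewrite ![upd (upd v j _) i _]updC 1?eq_sym //.
  by rewrite -!/(b _ _) !b0 add0r addr0 addrC => /eqP; rewrite addr_eq0 => /eqP.
have -> : v \o tperm i j = upd (upd v i (v j)) j (v i).
  apply/funext => l; rewrite /upd /=; case: tpermP => [->|->|/eqP/negbTE li /eqP/negbTE lj].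
  - by rewrite (negbTE ij) eqxx.
  - by rewrite eqxx.
  - by rewrite li lj.
by rewrite -/(b _ _) bD /b upd_id upd_id.
Qed.

Lemma alt_perm v (s : 'S_k) : a (v \o s) = (-1) ^+ s * a v.
Proof.
have [ts -> dts] := prod_tpermP s.
elim: ts dts v => [|[i j] ts IH] /= dts v.
  rewrite big_nil odd_perm1 mul1r; congr a.
  by apply/funext => l /=; rewrite perm1.
case/andP: dts => /= ij dts; rewrite big_cons /=.
rewrite odd_mul_tperm ij signr_addb expr1 -mulrA -(IH dts).
set s' := (\prod_(_ <- _) _)%g.
have -> : v \o (tperm i j * s')%g = (v \o s') \o tperm i j.
  by apply/funext => l; rewrite /= permM.
by rewrite alt_tperm // mulN1r.
Qed.

(* Replacing every v_i by v_i + t_i u: terms with u in two slots vanish. *)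
Lemma alt_shift v (t : 'I_k -> R) u :
  a (fun i => v i + t i *: u) = a v + \sum_i t i * a (upd v i u).
Proof.
have H m : forall v, a (fun i => if (i < m)%N then v i + t i *: u else v i) =
    a v + \sum_(i < k | (i < m)%N) t i * a (upd v i u).
  elim: m => [|m IH] v'; first by rewrite big_pred0 ?addr0.
  have [mk|km] := ltnP m k; last first.
    rewrite (eq_bigl (fun i : 'I_k => (i < m)%N)) => [|i]; last first.
      by rewrite ltnS leq_eqVlt; case: eqP => // im; move: (ltn_ord i); rewrite im ltnNge km.
    rewrite -IH; congr a; apply/funext => i.
    by rewrite (ltn_trans (ltn_ord i)) ?(leq_trans (ltn_ord i) km) // ltnS.
  pose o := Ordinal mk.
  pose w := fun i : 'I_k => if (i < m)%N then v' i + t i *: u else v' i.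
  have -> : (fun i : 'I_k => if (i < m.+1)%N then v' i + t i *: u else v' i) =
            upd w o (v' o + t o *: u).
    apply/funext => i; rewrite /upd /w ltnS leq_eqVlt -val_eqE /=.
    by case: eqP => //= im; rewrite (_ : i = o) //; apply: val_inj.
  rewrite mlin_add mlin_scale.
  have -> : upd w o (v' o) = w by rewrite -[RHS](upd_id _ o) /w /= ltnn.
  have -> : upd w o u = fun i : 'I_k => if (i < m)%N then upd v' o u i + t i *: u else upd v' o u i.
    apply/funext => i; rewrite /upd /w; case: eqP => // ->; by rewrite /= ltnn.
  rewrite !IH [X in _ + _ * (_ + X)]big1 => [|i im]; last first.
    have io : i != o by rewrite -val_eqE /= ltn_eqF.
    by rewrite (a_alt io) ?mulr0 // upd_eq upd_neq 1?eq_sym // upd_eq.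
  rewrite addr0 -addrA; congr (_ + _).
  rewrite [RHS](bigD1 o) //= addrC; congr (_ + _).
  by apply: eq_bigl => i; rewrite ltnS -val_eqE /=; case: ltngtP.
have -> : \sum_i t i * a (upd v i u) = \sum_(i < k | (i < k)%N) t i * a (upd v i u).
  by apply: eq_bigl => i; rewrite ltn_ord.
by rewrite -H; congr a; apply/funext => i; rewrite ltn_ord.
Qed.

End Multilinear.

(** A permutation of n + 1 letters is determined by the image i of j and by the permutation t that
    it induces on the other letters; bijectivity follows from injectivity by counting. *)
Lemma sum_lift_perm n (j : 'I_n.+1) (G : 'S_n.+1 -> R) :
  \sum_s G s = \sum_i \sum_(t : 'S_n) G (lift_perm j i t).
Proof.
rewrite pair_big /= (reindex (fun p : 'I_n.+1 * 'S_n => lift_perm j p.1 p.2)) //=.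
apply: onW_bij; apply: inj_card_bij => [[i s] [i' s'] /= e|]; last first.
  by rewrite card_prod card_ord !card_Sn factS.
have ii : i = i' by rewrite -(lift_perm_id j i s) e lift_perm_id.
rewrite -{i'}ii in e *; congr (_, _); apply/permP => l; apply: (@lift_inj _ i).
by rewrite -!(lift_perm_lift j) e.
Qed.

(** The transposition of two equal arguments fixes v, so a v = - a v, and 2 is invertible. *)
Lemma alternatingP k (a : ('I_k -> V) -> R) :
  (forall v (s : 'S_k), a (v \o s) = (-1) ^+ s * a v) -> alternating a.
Proof.
move=> aP v i j ij vij.
have /eqP := aP v (tperm i j); rewrite odd_tperm ij expr1 mulN1r.
rewrite (_ : v \o tperm i j = v) => [|]; last first.
  by apply/funext => l /=; case: tpermP => // ->.
by rewrite -addr_eq0 -mulr2n mulrn_eq0 => /eqP.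
Qed.

Lemma sgn_lift_perm n (i j : 'I_n.+1) (t : 'S_n) :
  (-1) ^+ lift_perm i j t = (-1) ^+ (i + j) * (-1) ^+ t :> R.
Proof. by rewrite odd_lift_perm !signr_addb !signr_odd exprD. Qed.

(* The alternating sum is, up to the factor n!, the antisymmetrization of f. *)
Lemma alternating_cofactor_sum n (f : V -> ('I_n -> V) -> R) :
  (forall u v (s : 'S_n), f u (v \o s) = (-1) ^+ s * f u v) ->
  alternating (fun v : 'I_n.+1 -> V =>
    \sum_(i < n.+1) (-1) ^+ i * f (v i) (fun j => v (lift i j))).
Proof.
move=> fP; pose G v (s : 'S_n.+1) :=
  (-1) ^+ s * f (v (s ord0)) (fun j => v (s (lift ord0 j))).
(* Group the permutations by the image i of [ord0]: the n! members of a group all contribute the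
   same term. *)
have GE v : n`!%:R * (\sum_(i < n.+1) (-1) ^+ i * f (v i) (fun j => v (lift i j)))
    = \sum_s G v s.
  rewrite (sum_lift_perm ord0) mulr_sumr; apply: eq_bigr => i _.
  rewrite (eq_bigr (fun _ => (-1) ^+ i * f (v i) (fun j => v (lift i j)))).
    by rewrite sumr_const card_Sn mulr_natl.
  move=> t _; rewrite /G sgn_lift_perm lift_perm_id.
  rewrite (_ : (fun j => _) = (fun j => v (lift i j)) \o t); last first.
    by apply/funext => j; rewrite /= lift_perm_lift.
  by rewrite fP -mulrA [_ * (_ * f _ _)]mulrA -signr_addb addbb mul1r.
apply: alternatingP => v s.
have n0 : n`!%:R != 0 :> R by rewrite pnatr_eq0 -lt0n fact_gt0.
apply: (mulfI n0); rewrite mulrCA !GE mulr_sumr.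
rewrite (reindex_inj (mulIg s^-1%g)) /=; apply: eq_bigr => t _.
rewrite /G /= !permM !permKV odd_permM odd_permV signr_addb [_ * (-1) ^+ s]mulrC -mulrA.
by congr (_ * (_ * f _ _)); apply/funext => j; rewrite /= permM permKV.
Qed.

Lemma vcons0 k u (v : 'I_k -> V) : vcons u v ord0 = u.
Proof. by rewrite /vcons unlift_none. Qed.

Lemma vcons_lift k u (v : 'I_k -> V) i : vcons u v (lift ord0 i) = v i.
Proof. by rewrite /vcons liftK. Qed.

Lemma vconsP k u (v : 'I_k -> V) (w : 'I_k.+1 -> V) :
  w ord0 = u -> (forall i, w (lift ord0 i) = v i) -> vcons u v = w.
Proof.
by move=> w0 wS; apply/funext => i; case: (unliftP ord0 i) => [j|] ->;
  rewrite ?vcons0 ?vcons_lift.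
Qed.

Lemma vcons_upd k u (v : 'I_k -> V) i w :
  vcons u (upd v i w) = upd (vcons u v) (lift ord0 i) w.
Proof.
apply: vconsP => [|j]; first by rewrite upd_neq ?vcons0.
by rewrite /upd vcons_lift (inj_eq lift_inj).
Qed.

Lemma vcons_upd0 k u w (v : 'I_k -> V) : vcons u v = upd (vcons w v) ord0 u.
Proof.
by apply: vconsP => [|i]; rewrite ?upd_eq // upd_neq ?vcons_lift.
Qed.

(** Bringing slot i to the front jumps over i slots; [lift_perm ord0 i 1] is the corresponding
    cycle. *)
Lemma alt_vcons n (a : ('I_n.+1 -> V) -> R) u v i :
  multilinear a -> alternating a ->
  a (upd v i u) = (-1) ^+ i * a (vcons u (fun j => v (lift i j))).
Proof.
move=> aL aA; have -> : vcons u (fun j => v (lift i j)) = upd v i u \o lift_perm ord0 i 1%g.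
  apply: vconsP => [|j] /=; first by rewrite lift_perm_id upd_eq.
  by rewrite lift_perm_lift perm1 upd_neq // eq_sym neq_lift.
rewrite alt_perm // sgn_lift_perm odd_perm1 mulr1 mulrA -exprD.
by rewrite add0n -signr_odd oddD addbb mul1r.
Qed.

End Alternating.

(** * Smooth maps and smooth forms *)

Section Smooth.
Context {R : realType}.
Implicit Types V W Z : normedModType R.

(** Lemmas such as [diff_lin] expect a bundled linear map, whereas the maps used below are plain
    functions with a proof of linearity. *)
Lemma linear_packed V W (f : V -> W) : linear f ->
  {L : {linear V -> W} | L = f :> (V -> W)}.
Proof.
move=> fL; pose m := GRing.isLinear.Build R V W *:%R f fL.
by exists (HB.pack_for {linear V -> W} f m).
Qed.

Lemma derive_linear V W (f : V -> W) x v : linear f -> continuous f ->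
  'D_v f x = f v.
Proof.
move=> /linear_packed[L <-] cL.
by rewrite deriveE ?diff_lin //; exact: linear_differentiable.
Qed.

Lemma diff_linear V W (f : V -> W) x : linear f -> continuous f ->
  'd f x = f :> (V -> W).
Proof. by move=> /linear_packed[L <-] cL; rewrite diff_lin. Qed.

Lemma differentiable_linear V W (f : V -> W) x : linear f -> continuous f ->
  differentiable f x.
Proof. by move=> /linear_packed[L <-] cL; exact: linear_differentiable. Qed.

Lemma smooth_onW V W (U : set V) (f : V -> W) : smooth_on setT f -> smooth_on U f.
Proof.
move=> H k; move: (H k) => {H}; elim: k f => [|k IH] f /=; first by move=> H x _; exact: H.
by case=> d H; split=> [x _|v]; [exact: d | exact: IH].
Qed.

Lemma Ck_onS V W k (U : set V) (f : V -> W) : Ck_on k.+1 U f -> Ck_on k U f.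
Proof.
elim: k f => [|k IH] f.
  by case=> d _ x Ux; exact/differentiable_continuous/d.
by case=> d H; split=> // v; exact: IH.
Qed.

Lemma smooth_differentiable V W (U : set V) (f : V -> W) x :
  smooth_on U f -> U x -> differentiable f x.
Proof. by move=> /(_ 1)[d _] Ux; exact: d. Qed.

Lemma smooth_derive V W (f : V -> W) v :
  smooth_on setT f -> smooth_on setT (fun x => 'D_v f x).
Proof. by move=> H k; have [_] := H k.+1; apply. Qed.

Lemma smooth_cst V W (w : W) : smooth_on setT (fun _ : V => w).
Proof.
move=> k; elim: k w => [|k IH] w /=; first by move=> x _; exact: cst_continuous.
split=> [x _|v]; first exact: differentiable_cst.
rewrite (_ : (fun x => _) = fun _ : V => 0 : W); first exact: IH.
by apply/funext => x; exact: derive_cst.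
Qed.

Lemma smooth_linear V W (f : V -> W) : linear f -> continuous f ->
  smooth_on setT f.
Proof.
move=> fL fc [|k] /=; first by move=> x _; exact: fc.
split=> [x _|v]; first exact: differentiable_linear.
rewrite (_ : (fun x => _) = fun _ : V => f v); first exact: smooth_cst.
by apply/funext => x; exact: derive_linear.
Qed.

Lemma Ck_onD V W k (f g : V -> W) : Ck_on k setT f -> Ck_on k setT g ->
  Ck_on k setT (fun x => f x + g x).
Proof.
elim: k f g => [|k IH] f g /=.
  by move=> F G x xT; apply: continuousD; [exact: F | exact: G].
move=> [df F] [dg G]; split=> [x _|v].
  by apply: differentiableD; [exact: df | exact: dg].
rewrite (_ : (fun x => _) = fun x => 'D_v f x + 'D_v g x); first exact: IH.
by apply/funext => x; apply: deriveD; apply: diff_derivable; [exact: df | exact: dg].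
Qed.

Lemma smoothD V W (f g : V -> W) : smooth_on setT f -> smooth_on setT g ->
  smooth_on setT (fun x => f x + g x).
Proof. by move=> F G k; exact: Ck_onD. Qed.

Lemma smooth_comp_linear V W Z (L : W -> Z) (f : V -> W) :
  linear L -> continuous L -> smooth_on setT f -> smooth_on setT (L \o f).
Proof.
move=> lL cL F k; move: (F k) => {F}; elim: k f => [|k IH] f /=.
  by move=> F x xT; apply: continuous_comp; [exact: F | exact: cL].
move=> [df F]; split=> [x _|v].
  by apply: differentiable_comp; [exact: df | exact: differentiable_linear].
rewrite (_ : (fun x => _) = L \o (fun x => 'D_v f x)); first exact: IH.
have dL := differentiable_linear _ lL cL; have dF y := df y I.
apply/funext => x; rewrite /= !deriveE //; last by apply: differentiable_comp.
by rewrite diff_comp //; exact: (congr1 (fun h : W -> Z => h ('d f x v)) (diff_linear (f x) lL cL)).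
Qed.

Lemma smooth_precomp_linear V W Z (f : W -> Z) (L : V -> W) :
  linear L -> continuous L -> smooth_on setT f -> smooth_on setT (f \o L).
Proof.
move=> lL cL F k; move: (F k) => {F}; elim: k f => [|k IH] f /=.
  by move=> F x xT; apply: continuous_comp; [exact: cL | exact: F].
move=> [df F]; split=> [x _|v].
  by apply: differentiable_comp; [exact: differentiable_linear | exact: df].
rewrite (_ : (fun x => _) = (fun x => 'D_(L v) f x) \o L); first exact: IH.
have dL := differentiable_linear _ lL cL; have dF y := df y I.
apply/funext => x; rewrite /= !deriveE //; last by apply: differentiable_comp.
by rewrite diff_comp //; exact: (congr1 (fun h : V -> W => 'd f (L x) (h v)) (diff_linear x lL cL)).
Qed.

Lemma smoothZ V W (t : R) (f : V -> W) : smooth_on setT f ->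
  smooth_on setT (fun x => t *: f x).
Proof.
apply: (@smooth_comp_linear _ _ _ ( *:%R t)); last exact: scaler_continuous.
by move=> s u w; rewrite scalerDr !scalerA mulrC.
Qed.

Lemma smoothM V (f g : V -> R^o) : smooth_on setT f -> smooth_on setT g ->
  smooth_on setT (fun x => f x * g x : R^o).
Proof.
move=> F G k; move: (F k) (G k) => {F G}.
elim: k f g => [|k IH] f g /=.
  by move=> F G x xT; apply: continuousM; [exact: F | exact: G].
move=> Ff Gg; have [df F] := Ff; have [dg G] := Gg; split=> [x _|v].
  by apply: differentiableM; [exact: df | exact: dg].
rewrite (_ : (fun x => _) = fun x => f x * 'D_v g x + g x * 'D_v f x : R^o).
  (* The product rule also contains [f] and [g] undifferentiated, which are of class k + 1 and enter
     here in class k. *)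
  by apply: Ck_onD; apply: IH => //; exact: Ck_onS.
by apply/funext => x; rewrite deriveM //; apply: diff_derivable; [exact: df | exact: dg].
Qed.

Lemma smooth_sum V W (I : finType) (f : I -> V -> W) :
  (forall i, smooth_on setT (f i)) -> smooth_on setT (fun x => \sum_i f i x).
Proof.
move=> F; rewrite (_ : (fun x => _) = \sum_i f i); last first.
  by apply/funext => x; rewrite fct_sumE.
elim/big_ind: _ => [||i _]; [exact: smooth_cst | by move=> g h; exact: smoothD | exact: F].
Qed.

Lemma smooth_scalel V W (f : V -> R^o) (w : W) : smooth_on setT f ->
  smooth_on setT (fun x => f x *: w).
Proof.
apply: (@smooth_comp_linear _ _ _ (fun t : R^o => t *: w)).
  by move=> s t u; rewrite scalerDl scalerA.
exact: scalel_continuous.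
Qed.

End Smooth.

(** * Closure of smooth differential forms under pullback, contraction and exterior derivative *)

Section FormClosure.
Context {R : realType}.
Implicit Types V W Z : normedModType R.

Lemma is_form_cst V k (a : ('I_k -> V) -> R) :
  multilinear a -> alternating a -> is_form (fun _ : V => a).
Proof. by move=> aL aA; split=> // v; exact: smooth_cst. Qed.

Lemma is_form_scalef V k t (a : form V k) : is_form a -> is_form (scalef t a).
Proof.
case=> aL aA aS; split=> [p v i s u w|p v i j ij vij|v].
- by rewrite /scalef aL mulrDr mulrCA.
- by rewrite /scalef (aA p v i j) ?mulr0.
- exact: (smoothZ t (aS v)).
Qed.

Lemma is_form_subf V k (a b : form V k) : is_form a -> is_form b ->
  is_form (subf a b).
Proof.
case=> aL aA aS [bL bA bS]; split=> [p v i s u w|p v i j ij vij|v].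
- by rewrite /subf aL bL; ring.
- by rewrite /subf (aA p v i j) ?(bA p v i j) ?subr0.
- apply: (@smoothD _ _ _ (fun p => a p v : R^o) (fun p => - b p v : R^o)) => //.
  rewrite (_ : (fun p => _) = fun p => -1 *: (b p v : R^o)); first exact: smoothZ.
  by apply/funext => p; rewrite scaleN1r.
Qed.

Lemma is_form_pullback V W k (L : V -> W) (a : form W k) :
  linear L -> continuous L -> is_form a -> is_form (pullback L a).
Proof.
move=> lL cL [aL aA aS].
have E p v : pullback L a p v = a (L p) (L \o v).
  by rewrite /pullback diff_linear.
have U v i u : L \o upd v i u = upd (L \o v) i (L u).
  by apply/funext => j; rewrite /upd /=; case: eqP.
split=> [p v i s u w|p v i j ij vij|v].
- by rewrite !E !U lL aL.
- by rewrite E (aA (L p) _ i j) //= vij.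
- rewrite (_ : (fun p => _) = (fun q => a q (L \o v) : R^o) \o L).
    exact: smooth_precomp_linear.
  by apply/funext => p; rewrite E.
Qed.

(** Smoothness is only known for [a] on constant vectors. Expanding X in constant vectors with
    smooth coefficients turns the contraction into a sum of products of smooth functions. *)
Lemma is_form_iprod V k (X : V -> V) (I : finType) (f : I -> V -> R^o)
    (e : I -> V) (a : form V k.+1) :
  (forall i, smooth_on setT (f i)) -> X = (fun p => \sum_i f i p *: e i) ->
  is_form a -> is_form (iprod X a).
Proof.
move=> fS -> [aL aA aS]; split=> [p v i s u w|p v i j ij vij|v].
- by rewrite /iprod !vcons_upd aL.
- by rewrite /iprod (aA p _ (lift ord0 i) (lift ord0 j)) ?(inj_eq lift_inj) // !vcons_lift.
- rewrite (_ : (fun p => _) = fun p => \sum_i (f i p * a p (vcons (e i) v) : R^o)).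
    by apply: smooth_sum => i; apply: smoothM.
  apply/funext => p; rewrite /iprod (vcons_upd0 _ 0) mlin_sum //.
  by apply: eq_bigr => i _; rewrite -vcons_upd0.
Qed.

Lemma is_form_extd V k (a : form V k) : is_form a -> is_form (extd a).
Proof.
case=> aL aA aS.
have aD v p : differentiable (fun q => a q v : R^o) p.
  exact: smooth_differentiable (aS v) _.
split=> [p v i s u w|p|v].
- rewrite /extd mulr_sumr -big_split; apply: eq_bigr => j _ /=.
  (* For [j = i] the modified slot is the direction of differentiation; otherwise it is an argument
     of [a]. *)
  have [->|ji] := eqVneq j i.
    have U z : (fun l => upd v i z (lift i l)) = v \o lift i.
      by apply: upd_comp_notin => l; rewrite eq_sym neq_lift.
    by rewrite !upd_eq !U !deriveE // linearP /=; rewrite -[_ *: _]/(_ * _); ring.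
  have [l il] : {l | i = lift j l}.
    by case: (unliftP j i) ji => [l ->|->]; [exists l | rewrite eqxx].
  have U z : (fun m => upd v i z (lift j m)) = upd (v \o lift j) l z.
    by rewrite il; apply: upd_comp; exact: lift_inj.
  rewrite !upd_neq // !U.
  pose F z : V -> R^o := fun q => a q (upd (v \o lift j) l z).
  have FD z : derivable (F z) p (v j) by apply: diff_derivable; exact: aD.
  rewrite -!/(F _) (_ : F (s *: u + w) = s *: F u + F w); last first.
    by apply/funext => q; exact: aL.
  rewrite (deriveD (derivableZ (k := s) (FD u)) (FD w)) (deriveZ s (FD u)).
  by rewrite -[_ *: _]/(_ * _); ring.
- apply: (@alternating_cofactor_sum _ _ _ (fun u w => 'D_u (fun q => a q w : R^o) p)).
  move=> u v s; rewrite (_ : (fun q => _) = (-1) ^+ s *: (fun q => a q v : R^o)).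
    by rewrite deriveZ //; apply: diff_derivable; exact: aD.
  by apply/funext => q; rewrite alt_perm.
- apply: smooth_sum => i; apply: smoothZ; exact: smooth_derive.
Qed.

End FormClosure.

(** * Differential ideals *)

Section Ideals.
Context {R : realType} {V : normedModType R}.
Implicit Types (k l n : nat) (M : set V) (T : V -> set V) (G : set (@hform R V)).

Lemma ideal_sub M T G G' : G `<=` ideal M T G' -> ideal M T G `<=` ideal M T G'.
Proof.
move=> GG' a; elim=> {a} [a Ga|k|k a b _ + _|k l b a bF _|k a b _ + bF ab].
- exact: GG'.
- exact: ideal_zero.
- exact: ideal_add.
- exact: ideal_wedge.
- by move=> /ideal_eq; apply.
Qed.

(* [wedge b th] has degree [n + 1], which is not convertible to the degree [n.+1]
   of [extd]. *)
Definition castf k l (e : k = l) (a : form V k) : form V l := ecast m (form V m) e a.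

Lemma castfE k l (e : k = l) (a : form V k) p v :
  castf e a p v = a p (fun i => v (cast_ord e i)).
Proof.
by case: l / e v => v /=; congr a; apply/funext => i; rewrite cast_ord_id.
Qed.

Lemma hf_cast k l (e : k = l) (a : form V k) : hf (castf e a) = hf a.
Proof. by case: l / e. Qed.

Lemma odd_cast_perm m n (e : m = n) (s : 'S_m) : odd_perm (cast_perm e s) = s.
Proof. by case: n / e; rewrite cast_perm_id. Qed.

(** Group the permutations by the position i that [th] reads, the image of the last letter. The n!
    orderings of the other positions give equal terms, which cancels the normalising factor of
    [wedge]. *)
Lemma wedge_form1 n (b : form V n) (th : form V 1) p v :
  multilinear (b p) -> alternating (b p) ->
  castf (addn1 n) (wedge b th) p v =
  \sum_(i < n.+1) (-1) ^+ (n + i) * b p (v \o lift i) * ev1 th p (v i).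
Proof.
move=> bL bA; rewrite castfE /wedge (_ : 1`! = 1)%N // muln1.
have n0 : n`!%:R != 0 :> R by rewrite pnatr_eq0 -lt0n fact_gt0.
apply: (mulfI n0); rewrite mulVKf //.
rewrite (reindex (cast_perm (esym (addn1 n)))) /=; last first.
  apply: onW_bij; exists (cast_perm (addn1 n)) => s.
    by rewrite -[RHS](cast_permKV (addn1 n)).
  by rewrite -[RHS](cast_permK (addn1 n)).
rewrite (sum_lift_perm ord_max) mulr_sumr; apply: eq_bigr => i _.
rewrite (eq_bigr (fun _ => (-1) ^+ (n + i) * b p (v \o lift i) * ev1 th p (v i))).
  by rewrite sumr_const card_Sn mulr_natl.
move=> t _; rewrite odd_cast_perm sgn_lift_perm /=.
pose u := lift_perm ord_max i t; pose u' := cast_perm (esym (addn1 n)) u.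
have vE (j : 'I_(n + 1)) :
    v (cast_ord (addn1 n) (u' j)) = v (u (cast_ord (addn1 n) j)).
  by rewrite cast_ord_permE (_ : cast_perm _ _ = u) // -[RHS](cast_permKV (addn1 n)).
have -> : (fun j => v (cast_ord (addn1 n) (u' (lshift 1 j)))) = (v \o lift i) \o t.
  apply/funext => j; rewrite vE /= (_ : cast_ord _ _ = lift ord_max j) ?lift_perm_lift //.
  by apply: val_inj; rewrite /= /bump leqNgt ltn_ord.
have -> : (fun j => v (cast_ord (addn1 n) (u' (rshift n j)))) = fun=> v i.
  apply/funext => j; rewrite vE (_ : cast_ord _ _ = ord_max) ?lift_perm_id //.
  by apply: val_inj; rewrite /= ord1 addn0.
rewrite alt_perm //; congr (_ * _).
by rewrite -mulrA [_ * (_ * b _ _)]mulrA -signr_addb addbb mul1r.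
Qed.

(* If a vanishes on ker th and th(X) = 1 then a = th /\ i_X a; the sign comes
   from writing th as the last factor. *)
Lemma form_divisible n (a : form V n.+1) (th : form V 1) (X : V -> V) p v :
  multilinear (a p) -> alternating (a p) ->
  a p (fun i => v i - ev1 th p (v i) *: X p) = 0 ->
  castf (addn1 n) (wedge (scalef ((-1) ^+ n) (iprod X a)) th) p v = a p v.
Proof.
move=> aL aA a0; rewrite wedge_form1.
- have := alt_shift aL aA v (fun i => - ev1 th p (v i)) (X p).
  rewrite (_ : (fun i => _) = fun i => v i - ev1 th p (v i) *: X p); last first.
    by apply/funext => i; rewrite scaleNr.
  rewrite a0 => /esym/eqP; rewrite addr_eq0 => /eqP ->.
  rewrite -sumrN; apply: eq_bigr => i _.
  rewrite alt_vcons // /scalef /iprod mulNr opprK.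
  have <- : (-1) ^+ (n + i) * (-1) ^+ n = (-1) ^+ i :> R.
    by rewrite -exprD addnAC addnn -mul2n exprD exprM sqrrN !expr1n mul1r.
  by rewrite mulrC !mulrA.
- by move=> w i s u z; rewrite /scalef /iprod !vcons_upd aL; ring.
- move=> w i j ij wij; rewrite /scalef /iprod.
  by rewrite (aA _ (lift ord0 i) (lift ord0 j)) ?mulr0 ?(inj_eq lift_inj) // !vcons_lift.
Qed.

(** When th(X) = 1, the vectors [v i - ev1 th p (v i) *: X p] are the projections of the [v i] to
    ker th along X, so the last hypothesis is a form of vanishing on ker th. *)
Lemma ideal_divisible M T G n (a : form V n.+1) (th : form V 1) (X : V -> V) :
  is_form a -> is_form (iprod X a) -> ideal M T G (hf th) ->
  (forall p, M p -> forall v : 'I_n.+1 -> V, (forall i, T p (v i)) ->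
     a p (fun i => v i - ev1 th p (v i) *: X p) = 0) ->
  ideal M T G (hf a).
Proof.
move=> aF XF thI a0; have [aL aA _] := aF.
apply: (@ideal_eq _ _ _ _ _ _ (castf (addn1 n) (wedge (scalef ((-1) ^+ n) (iprod X a)) th))) => //.
  by rewrite hf_cast; apply: ideal_wedge => //; exact: is_form_scalef.
by move=> p Mp v vT; rewrite form_divisible //; exact: a0.
Qed.

End Ideals.

(** Along a line the coefficients of [theta] and of omega are polynomials of degree at most 2, so
    their derivatives can be read off: for h non-zero the difference quotient is A + h B. *)
Lemma derive_quadratic (R : realType) (V : normedModType R) (f : V -> R^o)
    (p v : V) (A B : R) :
  (forall h, f (h *: v + p) = f p + h * A + h ^+ 2 * B) -> 'D_v f p = A.
Proof.
move=> fE; rewrite /derive; apply: cvg_lim => //.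
have H : A + h * B @[h --> (0 : R)^'] --> A.
  rewrite -[X in _ --> X]addr0 -[X in _ --> _ + X](mul0r B).
  apply: cvgD; first exact: cvg_cst.
  by apply: cvgM; [exact: nbhs_dnbhs | exact: cvg_cst].
apply: cvg_trans H; apply: near_eq_cvg.
near=> h; rewrite /= fE; set z := f p.
have h0 : h != 0 by near: h; exact: nbhs_dnbhs_neq.
by rewrite -[_ *: _]/(_ * _); field.
Unshelve. all: by end_near. Qed.

(** * Determinants and orthonormal pairs *)

Section Euclid.
Context {R : realType} {n : nat}.
Local Notation E := 'rV[R]_n.+2.
Local Notation EE := (E * E)%type.
Implicit Types (x y u v : E) (p : EE) (w b : 'I_n -> E).

Lemma dotE x y : dot x y = (x *m y^T) 0 0.
Proof. by rewrite mxE; apply: eq_bigr => i _; rewrite mxE. Qed.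

Lemma dotC x y : dot x y = dot y x.
Proof. by apply: eq_bigr => i _; rewrite mulrC. Qed.

Lemma dotDl x y v : dot (x + y) v = dot x v + dot y v.
Proof. by rewrite !dotE mulmxDl mxE. Qed.

Lemma dotZl t x v : dot (t *: x) v = t * dot x v.
Proof. by rewrite !dotE -scalemxAl mxE. Qed.

Lemma dotNl x v : dot (- x) v = - dot x v.
Proof. by rewrite -scaleN1r dotZl mulN1r. Qed.

Lemma dot0l v : dot 0 v = 0.
Proof. by rewrite -(scale0r 0) dotZl mul0r. Qed.

Lemma dotDr x y v : dot v (x + y) = dot v x + dot v y.
Proof. by rewrite dotC dotDl !(dotC v). Qed.

Lemma dotZr t x v : dot v (t *: x) = t * dot v x.
Proof. by rewrite dotC dotZl (dotC v). Qed.

Lemma dotNr x v : dot v (- x) = - dot v x.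
Proof. by rewrite dotC dotNl (dotC v). Qed.

Lemma dotBr x y v : dot v (x - y) = dot v x - dot v y.
Proof. by rewrite dotDr dotNr. Qed.

Lemma dot0r v : dot v 0 = 0.
Proof. by rewrite dotC dot0l. Qed.

Definition dot_lin := (dotDl, dotDr, dotZl, dotZr, dotNl, dotNr, dot0l, dot0r).

Lemma dot_ge0 x : 0 <= dot x x.
Proof. by apply: sumr_ge0 => i _; rewrite -expr2 sqr_ge0. Qed.

Lemma dot_eq0 x : dot x x = 0 -> x = 0.
Proof.
move=> /eqP; rewrite psumr_eq0 => [/allP x0|i _]; last by rewrite -expr2 sqr_ge0.
apply/rowP => i; rewrite mxE; apply/eqP.
by have := x0 i (mem_index_enum _); rewrite /= -expr2 sqrf_eq0.
Qed.

Lemma dot_sum (I : finType) (f : I -> R) (e : I -> E) x :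
  dot x (\sum_i f i *: e i) = \sum_i f i * dot x (e i).
Proof.
elim/big_ind2: _ => [|a b c d <- <-|i _]; first exact: dot0r.
  exact: dotDr.
exact: dotZr.
Qed.

Definition rowsmx k (v : 'I_k -> E) : 'M[R]_(k, n.+2) := \matrix_i v i.

Lemma row_rowsmx k (v : 'I_k -> E) i : row i (rowsmx v) = v i.
Proof. exact: rowK. Qed.

Lemma volE o (v : 'I_n.+2 -> E) : vol o v = \det (rowsmx v).
Proof.
by rewrite /vol /wedge1 -det_tr; congr (\det _); apply/matrixP => i j; rewrite !mxE.
Qed.

Lemma rowsmx_upd k (v : 'I_k -> E) i u : row' i (rowsmx (upd v i u)) = row' i (rowsmx v).
Proof.
by apply/matrixP => j l; rewrite !mxE upd_neq // eq_sym neq_lift.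
Qed.

Lemma vol_multilinear o : multilinear (@vol R n o).
Proof.
move=> v i t u w; rewrite !volE -[\det (rowsmx (upd v i w))]mul1r.
apply: (@determinant_multilinear _ _ _ _ _ i); rewrite ?rowsmx_upd //.
by rewrite !row_rowsmx !upd_eq scale1r.
Qed.

Lemma vol_alternating o : alternating (@vol R n o).
Proof.
move=> v i j ij vij; rewrite volE; apply: (determinant_alternate ij) => l.
by rewrite !mxE vij.
Qed.

(** If the determinant were non-zero, the matrix with rows v would be invertible and only the zero
    vector could be orthogonal to all rows. *)
Lemma vol_orthogonal o x (v : 'I_n.+2 -> E) : dot x x = 1 ->
  (forall i, dot x (v i) = 0) -> vol o v = 0.
Proof.
move=> x1 xv; rewrite volE; apply/eqP; case: eqP => // /eqP d0.
have Au : (rowsmx v)^T \in unitmx by rewrite unitmx_tr unitmxE unitfE.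
have xA : x *m (rowsmx v)^T = 0.
  apply/rowP => i; rewrite [RHS]mxE -(xv i) mxE.
  by apply: eq_bigr => j _; rewrite !mxE.
by move: x1; rewrite -(mulmxK Au x) xA mul0mx dot0l => /esym/eqP; rewrite oner_eq0.
Qed.

(** The two leading slots receive the radial field and the Reeb field. The base point [0] is
    arbitrary, since [vol] has constant coefficients. *)
Definition vol2 x y w : R := vol 0 (vcons x (vcons y w)).

Lemma vol2_orthogonal u x y w : dot u u = 1 -> dot u x = 0 -> dot u y = 0 ->
  (forall i, dot u (w i) = 0) -> vol2 x y w = 0.
Proof.
move=> u1 ux uy uw; apply: (vol_orthogonal _ u1) => i.
case: (unliftP ord0 i) => [j|] ->; rewrite ?vcons0 ?vcons_lift //.
by case: (unliftP ord0 j) => [l|] ->; rewrite ?vcons0 ?vcons_lift.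
Qed.

Lemma vol2_multilinear x y : multilinear (vol2 x y).
Proof. by move=> v i t u w; rewrite /vol2 !vcons_upd vol_multilinear. Qed.

Lemma vol2_linl x x' y w t :
  vol2 (t *: x + x') y w = t * vol2 x y w + vol2 x' y w.
Proof.
by rewrite /vol2 (vcons_upd0 _ 0) vol_multilinear -!vcons_upd0.
Qed.

Lemma vol2_linr x y y' w t :
  vol2 x (t *: y + y') w = t * vol2 x y w + vol2 x y' w.
Proof.
rewrite /vol2 (vcons_upd0 _ 0 w) vcons_upd vol_multilinear.
by rewrite -!vcons_upd -!vcons_upd0.
Qed.

Lemma vol2_anti x y w : vol2 y x w = - vol2 x y w.
Proof.
rewrite /vol2.
rewrite -(alt_tperm (vol_multilinear 0) (@vol_alternating 0) _ (neq_lift ord0 ord0)).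
congr vol; apply: vconsP => [|i] /=.
  by rewrite tpermL vcons_lift vcons0.
case: (unliftP ord0 i) => [j|] ->; last by rewrite tpermR !vcons0.
by rewrite tpermD ?vcons_lift // -val_eqE.
Qed.

Lemma vol2_Nr x y w : vol2 x (- y) w = - vol2 x y w.
Proof.
have := vol2_linr x y 0 w (-1); have := vol2_linr x 0 0 w 1.
rewrite scale1r addr0 mul1r scaleN1r addr0 => /eqP.
by rewrite eq_sym -subr_eq0 addrK => /eqP ->; rewrite addr0 mulN1r.
Qed.

(** Gives access to block matrix algebra; it relies on [2 + n] being convertible to [n.+2]. *)
Lemma rowsmx_vol2 x y w :
  rowsmx (vcons x (vcons y w)) = col_mx (col_mx x y) (rowsmx w) :> 'M[R]_(2 + n, n.+2).
Proof.
have E0 : ord0 = lshift n (lshift 1 (ord0 : 'I_1)) :> 'I_(2 + n) by exact: val_inj.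
have E1 : lift ord0 ord0 = lshift n (rshift 1 (ord0 : 'I_1)) :> 'I_(2 + n).
  exact: val_inj.
have E2 (j : 'I_n) : lift ord0 (lift ord0 j) = rshift 2 j :> 'I_(2 + n).
  exact: val_inj.
apply/row_matrixP => i; rewrite row_rowsmx.
case: (unliftP ord0 i) => [j|] ->; last first.
  rewrite vcons0 -[LHS](row_id ord0) -[LHS](rowKu ord0 x y) -[LHS](rowKu _ (col_mx x y) (rowsmx w)).
  by rewrite -E0.
rewrite vcons_lift; case: (unliftP ord0 j) => [l|] ->; last first.
  rewrite vcons0 -[LHS](row_id ord0) -[LHS](rowKd ord0 x y) -[LHS](rowKu _ (col_mx x y) (rowsmx w)).
  by rewrite -E1.
by rewrite vcons_lift -row_rowsmx -[LHS](rowKd _ (col_mx x y)) -E2.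
Qed.

Lemma vol2_det x y w : vol2 x y w = \det (col_mx (col_mx x y) (rowsmx w) : 'M[R]_(2 + n)).
Proof. by rewrite /vol2 volE rowsmx_vol2. Qed.

(** The left factor is block triangular with diagonal blocks 1 and B. With B = 1 this says that
    subtracting components along [A] keeps the determinant; with C = 0 it makes det B appear as a
    quotient of determinants, which is the curvature computation. *)
Lemma det_col_block m k (A : 'M[R]_(m, m + k)) (J : 'M[R]_(k, m + k)) C (B : 'M[R]_k) :
  \det (col_mx A (C *m A + B *m J)) = \det B * \det (col_mx A J).
Proof.
rewrite (_ : col_mx _ _ = block_mx 1%:M 0 C B *m col_mx A J); last first.
  by rewrite mul_block_col mul1mx mul0mx addr0.
by rewrite det_mulmx det_lblock det1 mul1r.
Qed.

Lemma complete_rows m k (A : 'M[R]_(m, m + k)) : row_free A ->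
  exists B : 'M[R]_(k, m + k), \det (col_mx A B) != 0.
Proof.
move=> Af; have rU : \rank (pid_mx m : 'M[R]_(m, m + k)) = m.
  by rewrite rank_pid_mx // leq_addr.
have UA : (pid_mx m : 'M[R]_(m, m + k)) *m col_mx A (0 : 'M[R]_(k, m + k)) = A.
  by rewrite pid_mx_row mul_row_col mul1mx mul0mx addr0.
(* [col_mx A 0] is injective on the span of the first m unit rows, so some invertible g agrees with
   it there; the remaining rows of g complete [A]. *)
have [|g gu gA] := @complete_unitmx _ _ _ (pid_mx m : 'M[R]_(m, m + k)) (col_mx A 0).
  by rewrite UA rU; apply/eqP.
exists (dsubmx g); rewrite (_ : A = usubmx g); last first.
  by rewrite -UA gA pid_mx_row -[in LHS](vsubmxK g) mul_row_col mul1mx mul0mx addr0.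
by rewrite vsubmxK -unitfE -unitmxE.
Qed.

(** * The orthogonal complement of an orthonormal pair *)

Section Orthonormal.
Context {x y : E}.
Hypotheses (xx : dot x x = 1) (yy : dot y y = 1) (xy : dot x y = 0).

Let A : 'M[R]_(1 + 1, n.+2) := col_mx x y.

(** With it [J *m A^T = 0] encodes that all rows of [J] are orthogonal to x and y, the form used
    throughout. *)
Lemma mul_frame_tr k (J : 'M[R]_(k, n.+2)) i : row i (J *m A^T) =
  row_mx (dot (row i J) x)%:M (dot (row i J) y)%:M.
Proof.
rewrite /A tr_col_mx mul_mx_row row_row_mx; congr row_mx;
  by apply/rowP => j; rewrite ord1 dotE -row_mul !mxE eqxx.
Qed.

Lemma frame_orthonormal : A *m A^T = 1%:M.
Proof.
rewrite /A tr_col_mx mul_col_row.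
rewrite [x *m x^T]mx11_scalar [x *m y^T]mx11_scalar [y *m x^T]mx11_scalar [y *m y^T]mx11_scalar.
rewrite -!dotE xx yy (dotC y x) xy; rewrite !raddf0 /=.
by rewrite -scalar_mx_block.
Qed.

Lemma frame_row_free : row_free A.
Proof. by apply/row_freeP; exists A^T; exact: frame_orthonormal. Qed.

Lemma exists_complement : exists b, vol2 x y b != 0.
Proof.
have [B Bd] := @complete_rows 2 n A frame_row_free.
exists (fun i => row i B); rewrite vol2_det (_ : rowsmx _ = B) //.
by apply/row_matrixP => i; rewrite row_rowsmx.
Qed.

(** Orthogonal projection to {x, y}^perp for an orthonormal pair. It is polynomial in (x, y), so
    that it turns constant vectors into smooth sections. *)
Definition proj x y u : E := u - dot u x *: x - dot u y *: y.

Lemma dot_proj u : dot x (proj x y u) = 0 /\ dot y (proj x y u) = 0.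
Proof.
rewrite /proj !dot_lin xx yy (dotC y x) xy (dotC x) (dotC y).
by split; ring.
Qed.

Lemma rowsmx_proj b :
  rowsmx (fun i => proj x y (b i)) = - (rowsmx b *m A^T) *m A + 1%:M *m rowsmx b.
Proof.
apply/row_matrixP => i; rewrite row_rowsmx mul1mx raddfD /= row_mul raddfN /=.
rewrite mul_frame_tr !row_rowsmx mulNmx mul_row_col !mul_scalar_mx /proj.
by rewrite [RHS]addrC opprD addrA.
Qed.

Lemma vol2_proj b : vol2 x y (fun i => proj x y (b i)) = vol2 x y b.
Proof.
by rewrite !vol2_det rowsmx_proj (@det_col_block 2) det1 mul1r.
Qed.

Lemma frame_coord (J : 'M[R]_(n, n.+2)) u :
  \det (col_mx A J : 'M[R]_(2 + n)) != 0 -> J *m A^T = 0 ->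
  dot u x = 0 -> dot u y = 0 -> exists a : 'rV_n, u = a *m J.
Proof.
move=> Sd JA ux uy; have Su : (col_mx A J : 'M[R]_(2 + n)) \in unitmx by rewrite unitmxE unitfE.
pose z : 'rV_(2 + n) := u *m invmx (col_mx A J : 'M[R]_(2 + n)).
have uE : u = lsubmx z *m A + rsubmx z *m J.
  by rewrite -mul_row_col hsubmxK mulmxKV.
have uA : u *m A^T = 0.
  rewrite -[u](row_id 0) -row_mul mul_frame_tr row_id ux uy !raddf0.
  by rewrite row_mx0.
(* Multiplication by [A^T] kills the [J] part and isolates the coordinates along x and y, which must
   therefore vanish. *)
move: uA; rewrite {1}uE mulmxDl -!mulmxA JA mulmx0 addr0 frame_orthonormal mulmx1 => z0.
by exists (rsubmx z); rewrite {1}uE z0 mul0mx add0r.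
Qed.

Lemma frame_free (J : 'M[R]_(n, n.+2)) (a : 'rV_n) :
  \det (col_mx A J : 'M[R]_(2 + n)) != 0 -> a *m J = 0 -> a = 0.
Proof.
move=> Sd aJ; have Su : (col_mx A J : 'M[R]_(2 + n)) \in unitmx by rewrite unitmxE unitfE.
have : row_mx (0 : 'rV_2) a *m (col_mx A J : 'M[R]_(2 + n)) = 0.
  by rewrite mul_row_col mul0mx add0r.
move/(congr1 (fun z => z *m invmx (col_mx A J : 'M[R]_(2 + n)))).
by rewrite mulmxK // mul0mx -row_mx0 => /eq_row_mx[].
Qed.

Lemma sum_rowsmx (a : 'I_n -> R) w :
  \sum_i a i *: w i = (\row_i a i) *m rowsmx w.
Proof.
by rewrite mulmx_sum_row; apply: eq_bigr => i _; rewrite row_rowsmx mxE.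
Qed.

(** For fixed b the condition is open in (x, y), which makes the projected vectors a local frame. *)
Lemma proj_frame b : vol2 x y b != 0 ->
  (forall a : 'I_n -> R, \sum_i a i *: proj x y (b i) = 0 -> forall i, a i = 0) /\
  (forall u, (dot x u = 0 /\ dot y u = 0) <->
     exists a : 'I_n -> R, u = \sum_i a i *: proj x y (b i)).
Proof.
rewrite -vol2_proj vol2_det => Sd; split=> [a|u].
  rewrite sum_rowsmx => /(frame_free Sd) /rowP a0 i.
  by have := a0 i; rewrite !mxE.
split=> [[ux uy]|[a ->]]; last first.
  rewrite !dot_sum; split; apply: big1 => i _; have [h1 h2] := dot_proj (b i);
    by rewrite ?h1 ?h2 mulr0.
have [|||a ->] := @frame_coord _ u Sd; rewrite 1?dotC //.
  apply/row_matrixP => i; rewrite mul_frame_tr row_rowsmx row0.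
  by have [h1 h2] := dot_proj (b i); rewrite !(dotC _ x) !(dotC _ y) h1 h2 !raddf0 row_mx0.
exists (fun i => a 0 i); rewrite sum_rowsmx; congr (_ *m _).
by apply/rowP => i; rewrite mxE.
Qed.

End Orthonormal.

End Euclid.

Lemma fst_linear (R : realType) (V W : normedModType R) :
  linear (fst : V * W -> V).
Proof. by []. Qed.

Lemma snd_linear (R : realType) (V W : normedModType R) :
  linear (snd : V * W -> W).
Proof. by []. Qed.

Lemma fst_continuous (R : realType) (V W : normedModType R) :
  continuous (fst : V * W -> V).
Proof. by move=> p; exact: cvg_fst. Qed.

Lemma snd_continuous (R : realType) (V W : normedModType R) :
  continuous (snd : V * W -> W).
Proof. by move=> p; exact: cvg_snd. Qed.

Lemma diff_fst (R : realType) (V W : normedModType R) (p : V * W) :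
  'd (fst : V * W -> V) p = fst :> (V * W -> V).
Proof. exact: diff_linear (@fst_linear R V W) (@fst_continuous R V W). Qed.

Lemma diff_snd (R : realType) (V W : normedModType R) (p : V * W) :
  'd (snd : V * W -> W) p = snd :> (V * W -> W).
Proof. exact: diff_linear (@snd_linear R V W) (@snd_continuous R V W). Qed.

Lemma comp_vcons (R : realType) (V W : normedModType R) k (f : V -> W) u (v : 'I_k -> V) :
  f \o vcons u v = vcons (f u) (f \o v).
Proof.
by apply/esym/vconsP => [|i] /=; rewrite ?vcons0 ?vcons_lift.
Qed.

(** * The contact structure of the unit tangent bundle *)

Section UnitTangent.
Context {R : realType} {n : nat}.
Local Notation E := 'rV[R]_n.+2.
Local Notation EE := (E * E)%type.
Local Notation T1S := (@T1S R n).
Local Notation theta := (@theta R n).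
Local Notation tan_T1S := (@tan_T1S R n).
Local Notation D := (contact_dist tan_T1S theta).
Local Notation reebT1S := (@reebT1S R n).
Implicit Types (p u v : EE).

Lemma smooth_coord (V : normedModType R) m (f : V -> 'rV[R]_m) i :
  linear f -> continuous f -> smooth_on setT (fun q => f q 0 i : R^o).
Proof.
move=> lf cf; apply: smooth_linear => [s u w|q].
  by rewrite lf !mxE.
by apply: (@continuous_comp _ _ _ f (fun z : 'rV_m => z 0 i));
  [exact: cf | exact: coord_continuous].
Qed.

Lemma smooth_coord1 i : smooth_on setT (fun q : EE => q.1 0 i : R^o).
Proof. exact: smooth_coord (@fst_linear _ _ _) (@fst_continuous _ _ _). Qed.

Lemma smooth_coord2 i : smooth_on setT (fun q : EE => q.2 0 i : R^o).
Proof. exact: smooth_coord (@snd_linear _ _ _) (@snd_continuous _ _ _). Qed.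

Lemma smooth_dot (V : normedModType R) (b : E) (f : V -> E) :
  (forall i, smooth_on setT (fun q => f q 0 i : R^o)) ->
  smooth_on setT (fun q => dot b (f q) : R^o).
Proof.
move=> fS; apply: smooth_sum => i; apply: smoothM; [exact: smooth_cst | exact: fS].
Qed.

Lemma smooth_rV (V : normedModType R) m (f : V -> 'rV[R]_m) :
  (forall i, smooth_on setT (fun q => f q 0 i : R^o)) -> smooth_on setT f.
Proof.
move=> fS; rewrite (_ : f = fun q => \sum_i f q 0 i *: delta_mx 0 i); last first.
  by apply/funext => q; exact: row_sum_delta.
by apply: smooth_sum => i; exact: (smooth_scalel (delta_mx 0 i) (fS i)).
Qed.

Lemma inl_linear : linear (fun z : E => (z, 0) : EE).
Proof. by move=> s u w; congr (_, _); rewrite /= scaler0 addr0. Qed.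

Lemma inr_linear : linear (fun z : E => (0, z) : EE).
Proof. by move=> s u w; congr (_, _); rewrite /= scaler0 addr0. Qed.

Lemma inl_continuous : continuous (fun z : E => (z, 0) : EE).
Proof.
by move=> z; apply: differentiable_continuous; exact: differentiable_pair.
Qed.

Lemma inr_continuous : continuous (fun z : E => (0, z) : EE).
Proof.
by move=> z; apply: differentiable_continuous; exact: differentiable_pair.
Qed.

Lemma smooth_reeb : smooth_on setT reebT1S.
Proof.
apply: smooth_linear => [s u w|z].
  by congr (_, _); rewrite /= opprD scalerN.
apply: differentiable_continuous; apply: differentiable_pair.
  exact: differentiable_linear (@snd_linear _ _ _) (@snd_continuous _ _ _).
apply: differentiableN.
exact: differentiable_linear (@fst_linear _ _ _) (@fst_continuous _ _ _).
Qed.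

Lemma is_form_iprod_reeb k (a : form EE k.+1) : is_form a -> is_form (iprod reebT1S a).
Proof.
pose f (j : 'I_n.+2 + 'I_n.+2) (q : EE) : R^o :=
  match j with inl i => q.2 0 i | inr i => - q.1 0 i end.
pose e (j : 'I_n.+2 + 'I_n.+2) : EE :=
  match j with inl i => (delta_mx 0 i, 0) | inr i => (0, delta_mx 0 i) end.
apply: (@is_form_iprod _ _ _ _ _ f e).
  case=> i; first exact: smooth_coord2.
  rewrite (_ : f _ = fun q : EE => -1 *: (q.1 0 i : R^o)).
    by apply: smoothZ; exact: smooth_coord1.
  by apply/funext => q; rewrite scaleN1r.
apply/funext => q; rewrite big_sumType /=.
have S (g : 'I_n.+2 -> R) (L : E -> EE) : linear L ->
    \sum_i g i *: L (delta_mx 0 i) = L (\row_i g i).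
  move=> /linear_packed[L' <-]; rewrite [\row_i g i]row_sum_delta linear_sum.
  by apply: eq_bigr => i _; rewrite linearZ mxE.
rewrite (S (fun i => q.2 0 i) _ inl_linear) (S (fun i => - q.1 0 i) _ inr_linear).
by congr (_, _); rewrite ?addr0 ?add0r; apply/rowP => i; rewrite !mxE.
Qed.

Lemma is_form_iprod_radial k (a : form E k.+1) : is_form a -> is_form (iprod (@radial R n) a).
Proof.
apply: (@is_form_iprod _ _ _ _ _ (fun (i : 'I_n.+2) (q : E) => q 0 i) (fun i => delta_mx 0 i)).
  by move=> i; apply: (@smooth_coord _ _ id) => // z; exact: cvg_id.
by apply/funext => q; exact: row_sum_delta.
Qed.

Lemma is_form_vol : is_form (@vol R n).
Proof.
rewrite (_ : @vol R n = fun _ => vol 0) //.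
by apply: is_form_cst; [exact: vol_multilinear | exact: vol_alternating].
Qed.

Lemma is_form_Omega1 c : is_form (@Omega1 R n c).
Proof. by apply: is_form_scalef; apply: is_form_iprod_radial; exact: is_form_vol. Qed.

Lemma is_form_Omega2 : is_form (@Omega2 R n).
Proof. by apply: is_form_iprod_radial; exact: is_form_vol. Qed.

Lemma is_form_pullback_fst k (a : form E k) : is_form a -> is_form (pullback (fst : EE -> E) a).
Proof. exact: is_form_pullback (@fst_linear _ _ _) (@fst_continuous _ _ _). Qed.

Lemma is_form_pullback_snd k (a : form E k) : is_form a -> is_form (pullback (snd : EE -> E) a).
Proof. exact: is_form_pullback (@snd_linear _ _ _) (@snd_continuous _ _ _). Qed.

Definition omega1 c : form EE n := iprod reebT1S (pullback fst (Omega1 c)).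
Definition omega2 : form EE n := iprod reebT1S (pullback snd (@Omega2 R n)).

Lemma is_form_omega1 c : is_form (omega1 c).
Proof. exact/is_form_iprod_reeb/is_form_pullback_fst/is_form_Omega1. Qed.

Lemma is_form_omega2 : is_form omega2.
Proof. exact/is_form_iprod_reeb/is_form_pullback_snd/is_form_Omega2. Qed.

Lemma omega1E c p (w : 'I_n -> EE) : omega1 c p w = c * vol2 p.1 p.2 (fst \o w).
Proof.
rewrite /omega1 /iprod /pullback /Omega1 /scalef /iprod diff_fst /vol2.
by rewrite -[fun i => _]/(fst \o vcons (reebT1S p) w) comp_vcons.
Qed.

(** The second component of the Reeb field is -x, so the contraction is det(y, -x, dy), which equals
    det(x, y, dy). *)
Lemma omega2E p (w : 'I_n -> EE) : omega2 p w = vol2 p.1 p.2 (snd \o w).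
Proof.
rewrite /omega2 /iprod /pullback /Omega2 /iprod diff_snd.
rewrite -[fun i => _]/(snd \o vcons (reebT1S p) w) comp_vcons.
by rewrite -[LHS]/(vol2 p.2 (- p.1) _) vol2_Nr vol2_anti opprK.
Qed.

Local Notation omega c := (induced_form reebT1S fst snd (Omega1 c) (@Omega2 R n)).

Lemma omegaE c p (w : 'I_n -> EE) :
  omega c p w = c * vol2 p.1 p.2 (fst \o w) - vol2 p.1 p.2 (snd \o w).
Proof. by rewrite -omega1E -omega2E. Qed.

Lemma is_form_omega c : is_form (omega c).
Proof.
apply: is_form_iprod_reeb; apply: is_form_subf.
  by apply: is_form_pullback_fst; exact: is_form_Omega1.
by apply: is_form_pullback_snd; exact: is_form_Omega2.
Qed.

Lemma thetaE p (v : 'I_1 -> EE) : theta p v = dot p.2 (v ord0).1.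
Proof. by []. Qed.

(** When theta vanishes on v, the mixed tangency condition reduces to x.v_2 = 0, so both components
    of v lie in {x, y}^perp. *)
Lemma contact_distP p v : D p v <->
  [/\ dot p.1 v.1 = 0, dot p.2 v.1 = 0, dot p.1 v.2 = 0 & dot p.2 v.2 = 0].
Proof.
rewrite /contact_dist /ev1 /=; split=> [[[a b c] d]|[a b c d]].
  by split=> //; move: c; rewrite dotC -[dot p.2 _]/(theta p (fun=> v)) d add0r.
by split=> //; split=> //; rewrite dotC b c addr0.
Qed.

Lemma extd_thetaE p (v : 'I_2 -> EE) : extd theta p v =
  dot (v ord0).2 (v (lift ord0 ord0)).1 - dot (v (lift ord0 ord0)).2 (v ord0).1.
Proof.
have H (z u : EE) : 'D_u (fun q : EE => dot q.2 z.1 : R^o) p = dot u.2 z.1.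
  apply: (@derive_quadratic _ _ _ _ _ _ 0) => h.
  by rewrite /= !dot_lin mulr0 addr0 addrC.
rewrite /extd !big_ord_recl big_ord0 addr0 expr0 mul1r expr1 mulN1r !H.
by congr (_ - dot _ (v _).1); apply: val_inj.
Qed.

Lemma extd_theta_ev2 p u v : ev2 (extd theta) p u v = dot u.2 v.1 - dot v.2 u.1.
Proof. by rewrite /ev2 extd_thetaE !vcons0 !vcons_lift. Qed.

Lemma is_form_theta : is_form theta.
Proof.
split=> [p v i t u w|p v i j|v].
- by rewrite !thetaE !ord1 !upd_eq /= !dot_lin.
- by rewrite !ord1 eqxx.
- rewrite (_ : (fun p => _) = fun p : EE => dot (v ord0).1 p.2 : R^o).
    by apply: smooth_dot => i; exact: smooth_coord2.
  by apply/funext => p; rewrite thetaE dotC.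
Qed.

Lemma T1S_contact_form : contact_form T1S tan_T1S theta.
Proof.
split=> [|p [xx yy xy]]; first exact: is_form_theta.
split=> [|u /contact_distP[u1 u2 u3 u4] H].
  exists (reebT1S p); rewrite /ev1 thetaE /= yy; split; last exact/eqP/oner_neq0.
  by split=> /=; rewrite ?dotNr ?xx ?yy ?subrr // (dotC p.2) xy oppr0.
(* Paired with this rotated vector, which again lies in D, the form d theta gives |u_1|^2 +
   |u_2|^2. *)
have := H (u.2, - u.1); rewrite extd_theta_ev2 /= dotNl opprK => H'.
have /eqP : dot u.2 u.2 + dot u.1 u.1 = 0.
  by apply: H'; apply/contact_distP; rewrite /= !dotNr u1 u2 u3 u4 oppr0.
rewrite paddr_eq0 ?dot_ge0 // => /andP[/eqP/dot_eq0 u20 /eqP/dot_eq0 u10].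
by rewrite [u]surjective_pairing u10 u20.
Qed.

Lemma reeb_tangent p : T1S p -> tan_T1S p (reebT1S p).
Proof.
case=> xx yy xy; split=> /=; rewrite ?dotNr ?xx ?yy ?subrr //.
by rewrite (dotC p.2) xy oppr0.
Qed.

Lemma ev1_reeb p : T1S p -> ev1 theta p (reebT1S p) = 1.
Proof. by case=> xx yy xy; rewrite /ev1 thetaE. Qed.

Lemma T1S_reeb_field : reeb_field T1S tan_T1S theta reebT1S.
Proof.
split=> [|p|p Mp v vT|p [xx yy xy] v vT]; first exact: smooth_reeb.
- exact: reeb_tangent.
- by rewrite -[RHS](ev1_reeb Mp) /iprod thetaE vcons0.
- rewrite /iprod extd_thetaE vcons0 vcons_lift /zerof /=.
  by have [a b _] := vT ord0; rewrite dotNl a dotC b oppr0 addr0.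
Qed.

(** * The vertical distributions as a Lagrangian pair *)

Lemma verticalE1 p v : vertical tan_T1S snd p v <-> tan_T1S p v /\ v.2 = 0.
Proof. by rewrite /vertical /= diff_snd. Qed.

Lemma verticalE2 p v : vertical tan_T1S fst p v <-> tan_T1S p v /\ v.1 = 0.
Proof. by rewrite /vertical /= diff_fst. Qed.

Lemma vertical1P p v : vertical tan_T1S snd p v <->
  (dot p.1 v.1 = 0 /\ dot p.2 v.1 = 0) /\ v.2 = 0.
Proof.
rewrite verticalE1; split=> [[[a b c] d]|[[a b] d]]; split=> //.
  by split=> //; move: c; rewrite d dot0r addr0 dotC.
by split; rewrite // d ?dot0r // addr0 dotC.
Qed.

Lemma vertical2P p v : vertical tan_T1S fst p v <->
  (dot p.1 v.2 = 0 /\ dot p.2 v.2 = 0) /\ v.1 = 0.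
Proof.
rewrite verticalE2; split=> [[[a b c] d]|[[a b] d]]; split=> //.
  by split=> //; move: c; rewrite d dot0l add0r.
by split; rewrite // d ?dot0r // dot0l add0r.
Qed.

Lemma smooth_proj (b : E) : smooth_on setT (fun q : EE => proj q.1 q.2 b).
Proof.
apply: smooth_rV => i.
rewrite (_ : (fun q => _) = fun q : EE => (b 0 i : R^o) +
   (-1 *: (dot b q.1 * q.1 0 i : R^o) + -1 *: (dot b q.2 * q.2 0 i : R^o))); last first.
  by apply/funext => q; rewrite /proj !mxE !scaleN1r addrA.
apply: smoothD; first exact: smooth_cst.
by apply: smoothD; apply: smoothZ; apply: smoothM; try (apply: smooth_dot => j);
  first [exact: smooth_coord1 | exact: smooth_coord2].
Qed.

Lemma smooth_vol2 (b : 'I_n -> E) : smooth_on setT (fun q : EE => vol2 q.1 q.2 b : R^o).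
Proof.
have [_ _ /(_ (fun i => (b i, 0)))] := is_form_omega1 1.
by congr smooth_on; apply/funext => q; rewrite omega1E mul1r.
Qed.

Lemma open_vol2 (b : 'I_n -> E) : open [set q : EE | vol2 q.1 q.2 b != 0].
Proof.
apply: (@open_comp _ _ (fun q : EE => vol2 q.1 q.2 b : R) [set z | z != 0]).
  by move=> q _; exact: (smooth_vol2 b 0).
exact: open_neq.
Qed.

(** Both vertical distributions are images of {x, y}^perp, under z -> (z, 0) and z -> (0, z), so one
    frame argument serves for the two. *)
Lemma subbundle_vertical (L : E -> EE) (F : EE -> set EE) :
  linear L -> continuous L -> injective L ->
  (forall p, T1S p -> F p `<=` tan_T1S p) ->
  (forall p v, F p v <-> exists2 u, dot p.1 u = 0 /\ dot p.2 u = 0 & v = L u) ->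
  subbundle T1S tan_T1S n F.
Proof.
move=> lL cL iL FT FE p Mp; split; first exact: FT.
have [xx yy xy] := Mp; have [b b0] := exists_complement xx yy xy.
have LS (a : 'I_n -> R) (e : 'I_n -> E) : \sum_i a i *: L (e i) = L (\sum_i a i *: e i).
  have [L' L'E] := linear_packed lL; rewrite -L'E linear_sum.
  by apply: eq_bigr => i _; rewrite linearZ.
have L0 : L 0 = 0 by have := lL (-1) 0 0; rewrite !scaleN1r !addNr.
exists [set q : EE | vol2 q.1 q.2 b != 0], (fun i q => L (proj q.1 q.2 (b i))); split=> //.
- exact: open_vol2.
- by move=> i; apply: smooth_onW; apply: (smooth_comp_linear lL cL); exact: smooth_proj.
move=> q [xx' yy' xy'] Uq; have [fr sp] := proj_frame xx' yy' xy' Uq.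
split=> [a|v].
  by rewrite LS -L0 => /iL; exact: fr.
rewrite FE; split=> [[u /sp[a ->] ->]|[a ->]]; first by exists a; rewrite LS.
by exists (\sum_i a i *: proj q.1 q.2 (b i)); [apply/sp; exists a | rewrite LS].
Qed.

Lemma T1S_lagrangian_pair :
  lagrangian_pair T1S tan_T1S theta n (vertical tan_T1S snd) (vertical tan_T1S fst).
Proof.
split.
- apply: (subbundle_vertical inl_linear inl_continuous); first by move=> u v [].
    by move=> p Mp v [].
  move=> p v; rewrite vertical1P; split=> [[h v2]|[u h ->]] //.
  by exists v.1 => //; rewrite -v2 -surjective_pairing.
- apply: (subbundle_vertical inr_linear inr_continuous); first by move=> u v [].
    by move=> p Mp v [].
  move=> p v; rewrite vertical2P; split=> [[h v2]|[u h ->]] //.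
  by exists v.2 => //; rewrite -v2 -surjective_pairing.
- move=> p Mp; split=> v.
    by move=> /vertical1P[[h1 h2] h3]; apply/contact_distP; rewrite h1 h2 h3 !dot0r.
  by move=> /vertical2P[[h1 h2] h3]; apply/contact_distP; rewrite h1 h2 h3 !dot0r.
- move=> p Mp u v; rewrite extd_theta_ev2.
  case=> -[[_]] hu [_] hv.
    by move: hu hv; rewrite !diff_snd => -> ->; rewrite !dot0l subrr.
  by move: hu hv; rewrite !diff_fst => -> ->; rewrite !dot0r subrr.
- move=> p Mp v /contact_distP[h1 h2 h3 h4]; exists ((v.1, 0), (0, v.2)).
  split=> [|[[a1 a2] [b1 b2]] [/= /vertical1P[_ /= ->] /vertical2P[_ /= ->] ->]].
    split; [exact/vertical1P|exact/vertical2P|].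
    by rewrite [LHS]surjective_pairing; congr (_, _); rewrite /= ?addr0 ?add0r.
  by rewrite /= addr0 add0r.
Qed.

Lemma sphere_volume_form c : c != 0 -> volume_form (@sphere R n) tan_sphere (Omega1 c).
Proof.
move=> c0; split=> [|x xx]; first exact: is_form_Omega1.
have xf : row_free x.
  by apply/row_freeP; exists x^T; rewrite [LHS]mx11_scalar -dotE xx.
have [B Bd] := @complete_rows R 1 n.+1 x xf.
(* Making the completing rows tangent to the sphere subtracts multiples of x, which does not change
   the determinant. *)
exists (fun i => row i B - dot (row i B) x *: x); split=> [i|].
  by rewrite /tan_sphere /= dotBr dotZr xx mulr1 (dotC x) subrr.
rewrite /Omega1 /scalef /iprod volE; apply/eqP; rewrite mulf_neq0 //.
have -> : rowsmx (vcons (radial x) (fun i => row i B - dot (row i B) x *: x)) =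
    col_mx x (- (B *m x^T) *m x + 1%:M *m B) :> 'M[R]_(1 + n.+1, n.+2).
  apply/row_matrixP => i; rewrite row_rowsmx.
  case: (unliftP ord0 i) => [j|] ->; rewrite ?vcons0 ?vcons_lift.
    rewrite -[RHS](_ : row j (- (B *m x^T) *m x + 1%:M *m B) = _); last first.
      by rewrite -[LHS](rowKd _ x); congr row; exact: val_inj.
    rewrite mul1mx raddfD /= row_mul raddfN /= mulNmx addrC; congr (- _ + _).
    by rewrite row_mul [_ *m x^T]mx11_scalar mul_scalar_mx -dotE.
  rewrite -[LHS](row_id ord0) -[LHS](rowKu _ x (- (B *m x^T) *m x + 1%:M *m B)).
  by congr row; exact: val_inj.
by rewrite (@det_col_block R 1) det1 mul1r.
Qed.

(** Reduces the claim that [Omega2] is a volume form to the case c = 1 of [Omega1]. *)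
Lemma Omega1_1 : Omega1 1 = @Omega2 R n.
Proof. by apply/funext => p; apply/funext => v; rewrite /Omega1 /scalef mul1r. Qed.

End UnitTangent.

(** * The Monge-Ampère system *)

Section MongeAmpere.
Context {R : realType} {n : nat}.
Local Notation E := 'rV[R]_n.+2.
Local Notation EE := (E * E)%type.
Local Notation T1S := (@T1S R n).
Local Notation theta := (@theta R n).
Local Notation tan_T1S := (@tan_T1S R n).
Local Notation D := (contact_dist tan_T1S theta).
Local Notation reebT1S := (@reebT1S R n).
Local Notation omega c := (induced_form reebT1S fst snd (Omega1 c) (@Omega2 R n)).
Local Notation MA c :=
  (induced_system T1S tan_T1S theta reebT1S fst snd (Omega1 c) (@Omega2 R n)).
Implicit Types (x y : E) (p u v : EE).

Lemma vol2_zero x y (w : 'I_n -> E) i : w i = 0 -> vol2 x y w = 0.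
Proof. exact: mlin_zero (vol2_multilinear x y) _ _. Qed.

Lemma T1S_ma_system c : c != 0 ->
  ma_system T1S tan_T1S theta n (vertical tan_T1S snd) (vertical tan_T1S fst) (MA c).
Proof.
move=> c0; exists (omega c); split=> // [|p _]; first exact: is_form_omega.
(* The decomposition of omega is global, so one neighbourhood serves for all points. *)
exists setT, (omega1 c), (@omega2 R n); split.
- by split=> //; exact: openT.
- by split; [exact: is_form_omega1 | exact: is_form_omega2].
move=> q [xx yy xy] _; have [b b0] := exists_complement xx yy xy.
have b1 := dot_proj xx yy xy; split=> //.
- move=> v _ [i /verticalE2[_ vi]].
  by rewrite omega1E (vol2_zero _ _ (i := i)) ?mulr0.
- move=> v _ [i /verticalE1[_ vi]].
  by rewrite omega2E (vol2_zero _ _ (i := i)).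
- exists (fun i => (proj q.1 q.2 (b i), 0)); split=> [i|].
    by apply/vertical1P; split=> //; exact: b1.
  by rewrite omega1E [vol2 _ _ _]vol2_proj //; apply/eqP; rewrite mulf_neq0.
- exists (fun i => (0, proj q.1 q.2 (b i))); split=> [i|].
    by apply/vertical2P; split=> //; exact: b1.
  by rewrite omega2E [vol2 _ _ _]vol2_proj //; apply/eqP.
Qed.

Lemma derive_omega c p u (w : 'I_n -> EE) :
  'D_u (fun q => omega c q w : R^o) p =
  c * (vol2 u.1 p.2 (fst \o w) + vol2 p.1 u.2 (fst \o w))
  - (vol2 u.1 p.2 (snd \o w) + vol2 p.1 u.2 (snd \o w)).
Proof.
(* The coefficient of h^2 comes from replacing both x and y by the components of u. *)
apply: (@derive_quadratic _ _ _ _ _ _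
  (c * vol2 u.1 u.2 (fst \o w) - vol2 u.1 u.2 (snd \o w))) => h.
by rewrite !omegaE /= !vol2_linl !vol2_linr; ring.
Qed.

(* Each term is a determinant of n+2 vectors orthogonal to x, or to y. *)
Lemma extd_omega_contact c p (v : 'I_n.+1 -> EE) : T1S p ->
  (forall i, D p (v i)) -> extd (omega c) p v = 0.
Proof.
move=> [xx yy xy] vD; have {}vD i := iffLR (contact_distP _ _) (vD i).
rewrite /extd big1 // => i _; have [i1 i2 i3 i4] := vD i.
have yx : dot p.2 p.1 = 0 by rewrite dotC.
have w12 j := let: And4 a b d e := vD (lift i j) in conj (conj a b) (conj d e).
(* Each of the four determinants is orthogonal to the one of x and y that differentiation has
   replaced. *)
rewrite derive_omega (vol2_orthogonal (u := p.1) xx) //; last by move=> j; case: (w12 j) => -[].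
rewrite (vol2_orthogonal (u := p.2) yy) //; last by move=> j; case: (w12 j) => -[].
rewrite (vol2_orthogonal (u := p.1) xx) //; last by move=> j; case: (w12 j) => _ [].
rewrite (vol2_orthogonal (u := p.2) yy) //; last by move=> j; case: (w12 j) => _ [].
by rewrite addr0 mulr0 subr0 mulr0.
Qed.

Lemma sub_reeb_contact p v : T1S p -> tan_T1S p v ->
  D p (v - ev1 theta p v *: reebT1S p).
Proof.
move=> [xx yy xy] [v1 v2 v12]; apply/contact_distP; rewrite /ev1 thetaE /=.
have yx : dot p.2 p.1 = 0 by rewrite dotC.
rewrite !dotBr !dotZr !dotNr xx yy xy yx v1 v2; split; try ring.
by move: v12; rewrite dotC => /eqP; rewrite addr_eq0 => /eqP ->; ring.
Qed.

Lemma MA_eds c : MA c = eds T1S tan_T1S [set hf theta; hf (omega c)].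
Proof.
rewrite /eds; apply/seteqP; split; apply: ideal_sub => a.
  case=> [[->|->]|->]; apply: ideal_gen; [left; left| right | left; right] => //.
  by exists (hf theta) => //; left.
case=> [[->|->]|[_ [->|->] <-]] /=; try (by apply: ideal_gen; left; left);
  try (by apply: ideal_gen; right); try (by apply: ideal_gen; left; right).
(* Only the generator d omega is left, the others belonging to both sets. *)
apply: (@ideal_divisible _ _ _ _ _ _ _ theta reebT1S).
- exact/is_form_extd/is_form_omega.
- exact/is_form_iprod_reeb/is_form_extd/is_form_omega.
- by apply: ideal_gen; left; left.
- move=> p Mp v vT; apply: extd_omega_contact => // i.
  exact: sub_reeb_contact.
Qed.

(** [breve2 dx i j] and [breve2 dy i j] unfold to this minor of the first, respectively second,
    components of the arguments. *)
Definition minor2 (w : 'I_n -> E) (i j : 'I_n.+2) : R :=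
  \det (\matrix_(m < n, l < n)
    w l 0 (nth ord0 [seq k <- enum 'I_n.+2 | k \notin [:: i; j]] m)).

Lemma minor2C w i j : minor2 w i j = minor2 w j i.
Proof.
congr (\det _); apply/matrixP => m l; rewrite !mxE; congr (w l 0 (nth _ _ m)).
by apply: eq_filter => k; rewrite !inE orbC.
Qed.

(** Both lists are strictly increasing and have the same members. *)
Lemma enum_without2 (i : 'I_n.+2) (k : 'I_n.+1) :
  [seq z <- enum 'I_n.+2 | z \notin [:: i; lift i k]] =
  [seq lift i (lift k m) | m <- enum 'I_n].
Proof.
pose lt_ord m : rel 'I_m := fun a b => (a < b)%N.
have lt_tr m : transitive (lt_ord m) by move=> a b d; exact: ltn_trans.
have enum_lt m : sorted (lt_ord m) (enum 'I_m).
  by rewrite -(sorted_map (f := val) (e' := ltn)) val_enum_ord iota_ltn_sorted.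
apply: (@irr_sorted_eq _ (lt_ord _) (lt_tr _)).
- by move=> a; exact: ltnn.
- exact: sorted_filter (@lt_tr _) _ _ (enum_lt _).
- rewrite sorted_map; apply: sub_sorted (enum_lt n) => a b.
  by rewrite /lt_ord /= !ltnNge !leq_bump2.
move=> z; rewrite mem_filter !inE mem_enum andbT.
apply/idP/mapP => [|[m _ ->]]; last first.
  by rewrite (inj_eq lift_inj) negb_or -!(eq_sym _ (lift _ _)) !neq_lift.
case: (unliftP i z) => [j|] ->; last by rewrite eqxx.
rewrite (inj_eq lift_inj) negb_or => /andP[_].
case: (unliftP k j) => [m|] ->; last by rewrite eqxx.
by exists m; rewrite ?mem_enum.
Qed.

Lemma minor2_lift w (i : 'I_n.+2) (k : 'I_n.+1) :
  minor2 w i (lift i k) = \det (\matrix_(l < n, m < n) w l 0 (lift i (lift k m))).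
Proof.
rewrite -det_tr; congr (\det _); apply/matrixP => l m; rewrite !mxE.
rewrite enum_without2 (nth_map l) ?size_enum_ord //.
by rewrite nth_ord_enum.
Qed.

(** Laplace expansion along the first two rows. Once column i is deleted, the column of index k is
    the original column k if k < i and k + 1 otherwise; this shift changes the sign and explains the
    two sums. *)
Lemma vol2_expand x y w : vol2 x y w =
  \sum_(i < n.+2) \sum_(j < n.+2 | (j < i)%N)
     (-1) ^+ (i + j) * x 0 i * y 0 j * minor2 w j i -
  \sum_(i < n.+2) \sum_(k < n.+2 | (i < k)%N)
     (-1) ^+ (i + k) * x 0 i * y 0 k * minor2 w i k.
Proof.
rewrite /vol2 volE (expand_det_row _ ord0) -sumrB; apply: eq_bigr => i _.
rewrite big_mkcond [X in _ - X]big_mkcond -sumrB (bigD1_ord i) //= ltnn subrr add0r.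
rewrite mxE vcons0 /cofactor (expand_det_row _ ord0) mulrA mulr_sumr.
apply: eq_bigr => k _; rewrite !mxE vcons_lift vcons0 /cofactor.
rewrite (_ : @row' _ n.+1 _ _ _ = \matrix_(l < n, m < n) w l 0 (lift i (lift k m))); last first.
  by apply/matrixP => l m; rewrite !mxE !vcons_lift.
rewrite -minor2_lift [minor2 _ (lift i k) i]minor2C add0n add0n.
rewrite /= /bump; have [ik|ki] := leqP i k.
  rewrite add1n ltnS ik ltnNge (leqW ik) /= sub0r exprD exprS.
  by move: ((-1) ^+ i) ((-1) ^+ k) => a b; ring.
rewrite add0n ki ltnNge (ltnW ki) /= subr0 exprD.
by move: ((-1) ^+ i) ((-1) ^+ k) => a b; ring.
Qed.

Lemma omega_formulaE c : eq_on T1S tan_T1S (omega c) (omega_formula c).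
Proof.
(* The explicit formula has y_i x_j in its dy part: exchanging x and y there absorbs the minus
   sign. *)
move=> p Mp v vT; rewrite omegaE -[X in _ - X]opprK -vol2_anti opprK.
by rewrite !vol2_expand mulrBr addrA.
Qed.

End MongeAmpere.

(** * Curvature of geometric solutions *)

Section Curvature.
Context {R : realType} {n : nat}.
Local Notation E := 'rV[R]_n.+2.
Local Notation EE := (E * E)%type.
Local Notation omega c := (induced_form (@reebT1S R n) fst snd (Omega1 c) (@Omega2 R n)).

Lemma derive_coord (V : normedModType R) (f : V -> E) q v i : differentiable f q ->
  'D_v (fun z => f z 0 i : R^o) q = ('D_v f q) 0 i.
Proof.
move=> df; pose L := fun z : E => z 0 i : R^o.
have lL : linear L by move=> s u w; rewrite /L !mxE.
have cL : continuous L by exact: coord_continuous.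
have dL z := differentiable_linear z lL cL.
rewrite -[fun z => _]/(L \o f) !deriveE //; last exact: differentiable_comp.
rewrite diff_comp //.
exact: (congr1 (fun h : E -> R => h ('d f q v)) (diff_linear (f q) lL cL)).
Qed.

Lemma differentiable_coordinate (V : normedModType R) (f : V -> E) q i :
  differentiable f q -> differentiable (fun z => f z 0 i : R^o) q.
Proof.
move=> df; apply: (@differentiable_comp _ _ _ _ f (fun z : E => z 0 i : R^o)) => //.
exact: differentiable_coord.
Qed.

Lemma derive_dot (V : normedModType R) (f g : V -> E) q v :
  differentiable f q -> differentiable g q ->
  'D_v (fun z => dot (f z) (g z) : R^o) q =
  dot ('D_v f q) (g q) + dot (f q) ('D_v g q).
Proof.
move=> df dg; have cf i := differentiable_coordinate i df.
have cg i := differentiable_coordinate i dg.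
rewrite (_ : (fun z => _) = \sum_(i < n.+2)
    ((fun z => f z 0 i : R^o) * (fun z => g z 0 i : R^o))); last first.
  by apply/funext => z; rewrite fct_sumE.
rewrite derive_sum => [|i]; last exact/diff_derivable/differentiableM.
rewrite /dot -big_split; apply: eq_bigr => i _ /=.
rewrite deriveM; [|exact/diff_derivable|exact/diff_derivable].
rewrite (derive_coord v i df) (derive_coord v i dg) [LHS]addrC.
by congr (_ + _); exact: mulrC.
Qed.

Lemma derive_dot_cst (V : normedModType R) (f g : V -> E) q v t :
  differentiable f q -> differentiable g q ->
  (\forall z \near q, dot (f z) (g z) = t) ->
  dot ('D_v f q) (g q) + dot (f q) ('D_v g q) = 0.
Proof.
move=> df dg fg; rewrite -derive_dot //.
rewrite (near_eq_derive (g := cst (t : R^o))) ?derive_cst //.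
Qed.

(** In row convention JN = B Jh says dN = B dh. The rows of [Jh] are n independent vectors of {x,
    y}^perp, hence a basis of it, and the rows of [JN] lie in their span. *)
Lemma tangent_endomorphism (x y : E) (Jh JN : 'M[R]_(n, n.+2)) :
  dot x x = 1 -> dot y y = 1 -> dot x y = 0 -> row_free Jh ->
  Jh *m (col_mx x y)^T = 0 -> JN *m (col_mx x y)^T = 0 ->
  \det (col_mx (col_mx x y) Jh : 'M[R]_(2 + n)) != 0 /\
  exists2 B : 'M[R]_n, JN = B *m Jh &
    \det (col_mx (col_mx x y) JN : 'M[R]_(2 + n)) =
    \det B * \det (col_mx (col_mx x y) Jh : 'M[R]_(2 + n)).
Proof.
move=> xx yy xy Jf JhA JNA.
have d0 : \det (col_mx (col_mx x y) Jh : 'M[R]_(2 + n)) != 0.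
  rewrite -unitfE -unitmxE -row_free_unit; apply: inj_row_free => z.
  rewrite -[z]hsubmxK mul_row_col => e.
  have z0 : lsubmx z = 0.
    have := congr1 (mulmx^~ (col_mx x y)^T) e.
    rewrite mulmxDl -!mulmxA JhA mulmx0 addr0 mul0mx.
    by rewrite (frame_orthonormal xx yy xy) mulmx1.
  move: e; rewrite z0 mul0mx add0r => e.
  have -> : rsubmx z = 0 by apply: (row_free_inj Jf); rewrite e mul0mx.
  by rewrite row_mx0.
split=> //; have /submxP[B JB] : (JN <= Jh)%MS.
  apply/row_subP => i; have [||a ->] := frame_coord xx yy xy d0 JhA (u := row i JN).
  - have := congr1 (row i) JNA; rewrite mul_frame_tr row0 -row_mx0 => /eq_row_mx[+ _].
    by move=> /matrixP/(_ 0 0); rewrite !mxE.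
  - have := congr1 (row i) JNA; rewrite mul_frame_tr row0 -row_mx0 => /eq_row_mx[_].
    by move=> /matrixP/(_ 0 0); rewrite !mxE.
  - exact: submxMl.
exists B => //; rewrite JB -(@det_col_block R 2 n _ Jh 0).
by rewrite mul0mx add0r.
Qed.

(** Reduces the curvature to an identity between the determinants of (h, N, dh) and (h, N, dN), in a
    form that applies to both projections by exchanging h and N. *)
Lemma gauss_curvatureP (L : topologicalType) (A : set (chart R n L))
    (h N : L -> E) l K :
  dot (h l) (h l) = 1 -> dot (N l) (N l) = 1 -> dot (h l) (N l) = 0 ->
  ~ singular_locus A h l ->
  (forall a, A a -> cdom a l -> exists Jh JN : 'M[R]_(n, n.+2),
    [/\ forall v, 'd (h \o cinv a) (cmap a l) v = v *m Jh,
        forall v, 'd (N \o cinv a) (cmap a l) v = v *m JN,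
        Jh *m (col_mx (h l) (N l))^T = 0, JN *m (col_mx (h l) (N l))^T = 0 &
      forall B : 'M[R]_n,
        \det (col_mx (col_mx (h l) (N l)) Jh : 'M[R]_(2 + n)) != 0 ->
        \det (col_mx (col_mx (h l) (N l)) JN : 'M[R]_(2 + n)) =
        \det B * \det (col_mx (col_mx (h l) (N l)) Jh : 'M[R]_(2 + n)) ->
        \det B = K]) ->
  gauss_curvature A h N l K.
Proof.
move=> hh NN hN sing H a Aa al dh dN.
(* The singular locus asks for one bad chart, so outside it dh is injective in every chart of [A]
   around l. *)
have ih : injective dh by apply: contrapT => nh; apply: sing; exists a.
have [Jh [JN [dhE dNE JhA JNA KE]]] := H a Aa al.
have Jf : row_free Jh.
  apply: inj_row_free => v v0; apply: ih.
  by rewrite /dh !dhE mul0mx.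
have [d0 [B JB detB]] := tangent_endomorphism hh NN hN Jf JhA JNA.
split=> //; split=> //; first by split=> //; rewrite dotC.
  move=> v; rewrite /dh dhE dotC.
  have := congr1 (row ord0) (congr1 (mulmx v) JhA).
  rewrite mulmxA mulmx0 mul_frame_tr row0 -row_mx0 => /eq_row_mx[_].
  by move=> /matrixP/(_ 0 0); rewrite row_id !mxE eqxx mulr1n.
exists B; last exact: KE.
by move=> v; rewrite [LHS]dNE [RHS]dhE JB mulmxA.
Qed.

Section Solution.
Context (L : topologicalType) (A : set (chart R n L)) (g : L -> EE) (c : R).
Hypothesis gS : geometric_solution A (@T1S R n) (@theta R n) (omega c) g.

Lemma solution_chart l a : A a -> cdom a l ->
  exists J1 J2 : 'M[R]_(n, n.+2),
  [/\ forall v, 'd ((fst \o g) \o cinv a) (cmap a l) v = v *m J1,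
      forall v, 'd ((snd \o g) \o cinv a) (cmap a l) v = v *m J2,
      J1 *m (col_mx (g l).1 (g l).2)^T = 0,
      J2 *m (col_mx (g l).1 (g l).2)^T = 0 &
      c * \det (col_mx (col_mx (g l).1 (g l).2) J1 : 'M[R]_(2 + n)) =
      \det (col_mx (col_mx (g l).1 (g l).2) J2 : 'M[R]_(2 + n))].
Proof.
have [gM gs _ gth gw] := gS; move=> Aa al.
set G := g \o cinv a; set q := cmap a l.
have [uq ql] := cmapP al; have Gq : G q = g l by rewrite /G /= ql.
have dG : differentiable G q := smooth_differentiable (gs a Aa) uq.
have df1 : differentiable (fst \o G) q.
  by apply: differentiable_comp => //; apply: differentiable_linear;
    [exact: fst_linear | exact: fst_continuous].
have df2 : differentiable (snd \o G) q.
  by apply: differentiable_comp => //; apply: differentiable_linear;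
    [exact: snd_linear | exact: snd_continuous].
have d1 v : 'd (fst \o G) q v = ('d G q v).1.
  rewrite diff_comp //; last by apply: differentiable_linear;
    [exact: fst_linear | exact: fst_continuous].
  exact: (congr1 (fun h : EE -> E => h ('d G q v)) (diff_fst (G q))).
have d2 v : 'd (snd \o G) q v = ('d G q v).2.
  rewrite diff_comp //; last by apply: differentiable_linear;
    [exact: snd_linear | exact: snd_continuous].
  exact: (congr1 (fun h : EE -> E => h ('d G q v)) (diff_snd (G q))).
(* Differentiate |x|^2 = 1, |y|^2 = 1 and x.y = 0, which hold along the whole chart because g takes
   values in [T1S]. *)
have T v : [/\ dot (g l).1 ('d G q v).1 = 0, dot (g l).2 ('d G q v).2 = 0 &
    dot (g l).2 ('d G q v).1 + dot (g l).1 ('d G q v).2 = 0].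
  have nearM (P : EE -> Prop) : (forall p, T1S p -> P p) -> \forall z \near q, P (G z).
    by move=> H; apply: filterE => z; apply: H; exact: gM.
  have h11 : \forall z \near q, dot ((fst \o G) z) ((fst \o G) z) = 1.
    by apply: (nearM (fun p => dot p.1 p.1 = 1)) => p [].
  have h22 : \forall z \near q, dot ((snd \o G) z) ((snd \o G) z) = 1.
    by apply: (nearM (fun p => dot p.2 p.2 = 1)) => p [].
  have h12 : \forall z \near q, dot ((fst \o G) z) ((snd \o G) z) = 0.
    by apply: (nearM (fun p => dot p.1 p.2 = 0)) => p [].
  have D1 : 'D_v (fst \o G) q = ('d G q v).1 := etrans (deriveE v df1) (d1 v).
  have D2 : 'D_v (snd \o G) q = ('d G q v).2 := etrans (deriveE v df2) (d2 v).
  have e1 := derive_dot_cst v df1 df1 h11; have e2 := derive_dot_cst v df2 df2 h22.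
  have e3 := derive_dot_cst v df1 df2 h12.
  move: e1 e2 e3; rewrite D1 D2 -[(fst \o G) q]/(G q).1 -[(snd \o G) q]/(G q).2 Gq.
  move: ('d G q v) => w; rewrite (dotC w.1 (g l).1) (dotC w.2 (g l).2) (dotC w.1 (g l).2).
  move=> /eqP e1 /eqP e2 ->; split=> //; apply/eqP.
    by rewrite -mulr2n mulrn_eq0 in e1.
  by rewrite -mulr2n mulrn_eq0 in e2.
have th v : dot (g l).2 ('d G q v).1 = 0.
  by have := gth a Aa q uq (fun=> v); rewrite /pullback -/G thetaE Gq.
have JA (J : 'M[R]_(n, n.+2)) :
    (forall i, dot (g l).1 (row i J) = 0 /\ dot (g l).2 (row i J) = 0) ->
    J *m (col_mx (g l).1 (g l).2)^T = 0.
  move=> J0; apply/row_matrixP => i; have [i1 i2] := J0 i.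
  by rewrite mul_frame_tr row0 !(dotC (row i J)) i1 i2 !raddf0 row_mx0.
pose J1 := lin1_mx ('d (fst \o G) q); pose J2 := lin1_mx ('d (snd \o G) q).
have J1E v : 'd (fst \o G) q v = v *m J1 := esym (mul_rV_lin1 _ v).
have J2E v : 'd (snd \o G) q v = v *m J2 := esym (mul_rV_lin1 _ v).
have rJ1 i : row i J1 = ('d G q (delta_mx 0 i)).1.
  by rewrite rowE; exact: etrans (esym (J1E _)) (d1 _).
have rJ2 i : row i J2 = ('d G q (delta_mx 0 i)).2.
  by rewrite rowE; exact: etrans (esym (J2E _)) (d2 _).
exists J1, J2; split; [exact: J1E | exact: J2E | | |].
- apply: JA => i; rewrite rJ1; split; last exact: th.
  by have [] := T (delta_mx 0 i).
- apply: JA => i; rewrite rJ2; have [_ h2 h3] := T (delta_mx 0 i); split=> //.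
  by move: h3; rewrite th add0r.
(* Evaluated on the standard basis, g^* omega = 0 is exactly the relation between the two
   determinants. *)
- have := gw a Aa q uq (fun i => delta_mx 0 i).
  rewrite /pullback -/G omegaE Gq !vol2_det.
  rewrite (_ : rowsmx (fst \o _) = J1); last first.
    by apply/row_matrixP => i; rewrite row_rowsmx rJ1.
  rewrite (_ : rowsmx (snd \o _) = J2); last first.
    by apply/row_matrixP => i; rewrite row_rowsmx rJ2.
  by move/eqP; rewrite subr_eq0 => /eqP.
Qed.

Lemma solution_curvature1 l : ~ singular_locus A (fst \o g) l ->
  gauss_curvature A (fst \o g) (snd \o g) l c.
Proof.
have [/(_ l)[xx yy xy] _ _ _ _] := gS.
move=> sing; apply: gauss_curvatureP => // a Aa al /=.
have [J1 [J2 [J1E J2E JA1 JA2 detJ]]] := solution_chart Aa al.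
exists J1, J2; split=> // B d0.
by rewrite -detJ => /(mulIf d0).
Qed.

Lemma solution_curvature2 l : c != 0 -> ~ singular_locus A (snd \o g) l ->
  gauss_curvature A (snd \o g) (fst \o g) l c^-1.
Proof.
have [/(_ l)[xx yy xy] _ _ _ _] := gS.
move=> c0 sing; apply: gauss_curvatureP => //=; first by rewrite dotC.
move=> a Aa al /=.
have [J1 [J2 [J1E J2E JA1 JA2 detJ]]] := solution_chart Aa al.
exists J2, J1.
have swapA (J : 'M[R]_(n, n.+2)) : J *m (col_mx (g l).1 (g l).2)^T = 0 ->
    J *m (col_mx (g l).2 (g l).1)^T = 0.
  by rewrite !tr_col_mx !mul_mx_row -!row_mx0 => /eq_row_mx[-> ->].
have swap (J : 'M[R]_(n, n.+2)) :
    \det (col_mx (col_mx (g l).2 (g l).1) J : 'M[R]_(2 + n)) =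
    - \det (col_mx (col_mx (g l).1 (g l).2) J : 'M[R]_(2 + n)).
  have -> : J = rowsmx (fun i => row i J).
    by apply/row_matrixP => i; rewrite row_rowsmx.
  by rewrite -!vol2_det vol2_anti.
split=> // [||B]; [exact: swapA | exact: swapA |].
rewrite !swap oppr_eq0 -detJ mulf_eq0 negb_or => /andP[_ d0].
(* Exchanging x and y changes the sign of both determinants. With d = det(x, y, dx) the hypothesis
   reads d = det B * c * d, and d is non-zero. *)
rewrite mulrN mulrA -[in LHS](mul1r (\det _)) => /oppr_inj /(mulIf d0) cB.
by rewrite -[LHS](mulfK c0) -cB mul1r.
Qed.

End Solution.
End Curvature.

Theorem proposition8p9 (R : realType) (n : nat) (c : R) (hc : c <> 0) :
  let E := 'rV[R]_n.+2 in
  let M : set (E * E) := T1S in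
  let T : E * E -> set (E * E) := tan_T1S in
  let pi1 : E * E -> E := fst in
  let pi2 : E * E -> E := snd in
  let E1 := vertical T pi2 in
  let E2 := vertical T pi1 in
  let omega := induced_form reebT1S pi1 pi2 (Omega1 c) Omega2 in
  let MA := induced_system M T theta reebT1S pi1 pi2 (Omega1 c) Omega2 in
  [/\ contact_form M T theta,
      reeb_field M T theta reebT1S,
      lagrangian_pair M T theta n E1 E2,
      volume_form (@sphere R n) tan_sphere (Omega1 c) &
      volume_form (@sphere R n) tan_sphere Omega2] /\
  [/\ ma_system M T theta n E1 E2 MA,
      MA = eds M T [set hf theta; hf omega] &
      eq_on M T omega (omega_formula c)] /\
  (forall (L : topologicalType) (A : set (chart R n L)), smooth_manifold A ->
   forall g : L -> E * E, geometric_solution A M theta omega g ->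
     (forall l, ~ singular_locus A (pi1 \o g) l ->
        gauss_curvature A (pi1 \o g) (pi2 \o g) l c) /\
     (forall l, ~ singular_locus A (pi2 \o g) l ->
        gauss_curvature A (pi2 \o g) (pi1 \o g) l c^-1)).
Proof.
have c0 : c != 0 by exact/eqP.
move=> E M T pi1 pi2 E1 E2 omega MA; split; [split|split; [split|]].
- exact: T1S_contact_form.
- exact: T1S_reeb_field.
- exact: T1S_lagrangian_pair.
- exact: sphere_volume_form.
- by rewrite -Omega1_1; apply: sphere_volume_form; exact: oner_neq0.
- exact: T1S_ma_system.
- exact: MA_eds.
- exact: omega_formulaE.
move=> L A _ g gS; split=> l sing.
  exact: solution_curvature1 gS _ sing.
exact: solution_curvature2 gS _ c0 sing.
Qed.
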